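(* Let $\mathbf P$ be a self-similar RAM constructed from i.i.d. fractions $\mathbf X=\{X_j\}_{j\ge1}$, and let $\mathbf T$ be an independent homogeneous Markov chain on the discrete space $\mathcal X$ with kernel $Q$ and initial distribution $\mu$, where $\mu$ assigns zero mass to transient states of $Q$. Let $\nu=\langle\sum_{j\ge1}P_j\delta_{T_j}(l):l\in\mathcal X\rangle$. For each recurrent state $i$ of $Q$, let $\mathbf T^i$ be a Markov chain with kernel $Q$ and $T^i_1=i$, independent of $\mathbf X$ and of $(\nu,T_1)$; let $W^i=\inf\{j>1:T^i_j=i\}$, $X^i=\sum_{j=1}^{W^i-1}X_j\prod_{l=1}^{j-1}(1-X_l)$, $\eta^i=(X^i)^{-1}\sum_{j=1}^{W^i-1}\big[X_j\prod_{l=1}^{j-1}(1-X_l)\big]\delta_{T^i_j}$, and let $\nu^i$ denote the conditional law of $\nu$ given $T_1=i$. Then the law of $(\nu,T_1)$ is the unique law satisfying: $T_1\sim\mu$ and, for each recurrent state $i$ of $Q$, $\nu^i\overset d=X^i\eta^i+(1-X^i)\tilde\nu^i$, where $\tilde\nu^i$ has the same law as $\nu^i$ and is independent of $(\eta^i,X^i)$.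
   Context: Conventions: empty sums $0$, empty products $1$. A RAM constructed from independent $[0,1]$-valued fractions $X_j$ is $P_j=X_j\prod_{i<j}(1-X_i)$, required to satisfy $\sum_jP_j=1$ a.s.; it is self-similar if the $X_j$ are i.i.d. *)

(* Defs.v *)
From HB Require Import structures.
From mathcomp Require Import all_boot all_order all_algebra.
From mathcomp Require Import all_classical all_reals all_analysis.

Set Implicit Arguments.
Unset Strict Implicit.
Unset Printing Implicit Defensive.

Import Order.TTheory GRing.Theory Num.Theory.
Import numFieldNormedType.Exports.
Local Open Scope classical_set_scope.
Local Open Scope ring_scope.

Definition dstate (S : Type) : Type := S.
HB.instance Definition _ (S : pointedType) := Pointed.on (dstate S).
HB.instance Definition _ (S : pointedType) :=
  @isMeasurable.Build default_measure_display (dstate S)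
    discrete_measurable discrete_measurable0
    discrete_measurableC discrete_measurableU.

(* The space of (random) measures on S, seen as weight functions       *)
(* l |-> nu(l), with the product (cylinder) sigma-algebra generated by *)
(* the evaluation maps f |-> f l.                                      *)
Definition cyl_gen (R : realType) (S : Type) : set (set (S -> R)) :=
  [set A | exists l (B : set R), measurable B /\ A = (fun f => f l) @^-1` B].

Definition mconf (R : realType) (S : pointedType) : Type :=
  g_sigma_algebraType (@cyl_gen R S).

Section Defs.
Context {R : realType}.

Section Kernel.
Context {S : pointedType}.

Definition prob_vector (mu : S -> R) : Prop :=
  (forall s, 0 <= mu s) /\ (\esum_(s in [set: S]) (mu s)%:E = 1)%E.

Definition stochastic_kernel (Q : S -> S -> R) : Prop :=
  forall i, prob_vector (Q i).

(* first_passage Q n i j = probability, for the chain with kernel Q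
   started at i, that the first visit to j at a positive time happens
   at time n.+1  (f^{(n+1)}_{ij} in Feller's notation). *)
Fixpoint first_passage (Q : S -> S -> R) (n : nat) (i j : S) : \bar R :=
  match n with
  | 0 => (Q i j)%:E
  | n'.+1 => (\esum_(k in [set k | k != j]) ((Q i k)%:E * first_passage Q n' k j))%E
  end.

Definition recurrent (Q : S -> S -> R) (i : S) : Prop :=
  (\sum_(n <oo) first_passage Q n i i = 1)%E.

Definition dirac_vec (i : S) : S -> R := fun s => (s == i)%:R.
End Kernel.

Section Processes.
Context {d : measure_display} {Omega : measurableType d} (P : probability Omega R).
Context {S : pointedType}.

(* indices are 0-based: X 0 is the paper's X_1, T 0 is the paper's T_1 *)
Definition cyl_X (X : nat -> Omega -> R) (n : nat) (A : nat -> set R) : set Omega :=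
  \bigcap_(j in [set j | (j < n)%N]) (X j @^-1` A j).

Definition cyl_T (T : nat -> Omega -> S) (n : nat) (s : nat -> S) : set Omega :=
  \bigcap_(j in [set j | (j < n)%N]) (T j @^-1` [set s j]).

Definition iid_fractions (X : nat -> Omega -> R) : Prop :=
  (forall j, measurable_fun [set: Omega] (X j)) /\
  (forall j w, 0 <= X j w <= 1) /\
  (forall n (A : nat -> set R), (forall j, measurable (A j)) ->
     P (cyl_X X n A) = \big[*%E/1%E]_(j < n) P (X 0%N @^-1` A j)).

Definition stick (X : nat -> Omega -> R) (j : nat) (w : Omega) : R :=
  X j w * \prod_(i < j) (1 - X i w).

Definition RAM_condition (X : nat -> Omega -> R) : Prop :=
  {ae P, forall w, (fun n => \sum_(j < n) stick X j w) @ \oo --> (1 : R)}.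

Definition markov_chain (Q : S -> S -> R) (mu : S -> R) (T : nat -> Omega -> S) : Prop :=
  (forall n s, measurable (T n @^-1` [set s])) /\
  (forall n (s : nat -> S),
     P (cyl_T T n.+1 s) = (mu (s 0%N) * \prod_(j < n) Q (s j) (s j.+1))%:E).

Definition indep_seq (X : nat -> Omega -> R) (T : nat -> Omega -> S) : Prop :=
  forall n (A : nat -> set R) (s : nat -> S), (forall j, measurable (A j)) ->
    P (cyl_X X n A `&` cyl_T T n s) = (P (cyl_X X n A) * P (cyl_T T n s))%E.

Definition ram_measure (X : nat -> Omega -> R) (T : nat -> Omega -> S)
    (w : Omega) : mconf R S :=
  fun l => limn (fun n => \sum_(j < n) stick X j w * (T j w == l)%:R).

Definition nuT (X : nat -> Omega -> R) (T : nat -> Omega -> S)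
    (w : Omega) : mconf R S * dstate S :=
  (ram_measure X T w, T 0%N w : dstate S).

Definition law_nuT (X : nat -> Omega -> R) (T : nat -> Omega -> S) :
    set (mconf R S * dstate S) -> \bar R :=
  pushforward P (nuT X T).

Definition indep_aux (X : nat -> Omega -> R) (T : nat -> Omega -> S)
    (Ti : nat -> Omega -> S) : Prop :=
  forall n (A : nat -> set R) (E : set (mconf R S * dstate S)) (s : nat -> S),
    (forall j, measurable (A j)) -> measurable E ->
    P (cyl_X X n A `&` (nuT X T @^-1` E) `&` cyl_T Ti n s) =
    (P (cyl_X X n A `&` (nuT X T @^-1` E)) * P (cyl_T Ti n s))%E.

(* excursion quantities.  exc_ind Ti i j w = 1 iff j < W^i - 1 in the
   paper's 1-based indexing, i.e. Ti does not return to i at times 1..j *)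
Definition exc_ind (Ti : nat -> Omega -> S) (i : S) (j : nat) (w : Omega) : R :=
  \prod_(1 <= k < j.+1) (Ti k w != i)%:R.

Definition exc_mass (X : nat -> Omega -> R) (Ti : nat -> Omega -> S) (i : S)
    (w : Omega) : R :=
  limn (fun n => \sum_(j < n) exc_ind Ti i j w * stick X j w).

Definition exc_eta (X : nat -> Omega -> R) (Ti : nat -> Omega -> S) (i : S)
    (w : Omega) : S -> R :=
  fun l => (exc_mass X Ti i w)^-1 *
    limn (fun n => \sum_(j < n) exc_ind Ti i j w * stick X j w * (Ti j w == l)%:R).
End Processes.

Definition mix {S : Type} (x : R) (eta : S -> R) (m : S -> R) : S -> R :=
  fun l => x * eta l + (1 - x) * m l.

Definition cond_law {S : pointedType}
    (lam : set (mconf R S * dstate S) -> \bar R) (i : S) : set (mconf R S) -> \bar R :=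
  fun B => (lam (B `*` [set i : dstate S]) * (lam ([set: mconf R S] `*` [set i : dstate S]))^-1)%E.

(* lam satisfies the characterization: T_1 ~ mu and, for every recurrent
   state i (charged by mu, so that the conditional law is defined),
   lam^i =d X^i eta^i + (1 - X^i) nu~ with nu~ ~ lam^i independent of
   (eta^i, X^i); the independent coupling is realized as the product
   space Omega x mconf with product measure P \x lam^i. *)
Definition fixed_point_char {d : measure_display} {Omega : measurableType d}
    (P : probability Omega R) {S : pointedType} (Q : S -> S -> R) (mu : S -> R)
    (X : nat -> Omega -> R) (Tr : S -> nat -> Omega -> S)
    (lam : set (mconf R S * dstate S) -> \bar R) : Prop :=
  (forall s : S, lam ([set: mconf R S] `*` [set s : dstate S]) = (mu s)%:E) /\
  (forall i : S, recurrent Q i -> 0 < mu i ->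
     forall B : set (mconf R S), measurable B ->
       (cond_law lam i B =
       (P \x cond_law lam i)
         ((fun p : Omega * mconf R S =>
             (mix (exc_mass X (Tr i) i p.1) (exc_eta X (Tr i) i p.1) p.2 : mconf R S))
            @^-1` B))%E).

End Defs.

(* Main.v *)
Require Import Defs.
From HB Require Import structures.
From mathcomp Require Import all_boot all_order all_algebra.
From mathcomp Require Import all_classical all_reals all_analysis.
From mathcomp Require Import measurable_realfun.
From mathcomp Require Import lra ring.
Import Order.TTheory GRing.Theory Num.Theory.
Import numFieldNormedType.Exports.
Local Open Scope classical_set_scope.
Local Open Scope ring_scope.

(* Existence: the path of the fractions and of the chain under [T_1 = i] has the
   same law as the path obtained by running an excursion [T^i] until its first
   return to [i] and then restarting with an independent copy of (fractions,
   chain).  This needs no summation over return times: the preimage of a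
   cylinder {X_j in A_j, T_j = s_j, j < n} under this splicing is a rectangle,
   cut at the first return of the deterministic path [s] to [i].  Evaluating the
   weighted occupation measure on the spliced path gives the right-hand side of
   the fixed-point equation, since an excursion from a recurrent state is a.s.
   finite.

   Uniqueness: the equation reads [m =d c + b m] with [b = 1 - X^i] in [0,1] and
   [E b < 1], so averaging a function that is Lipschitz in finitely many
   coordinates multiplies its Lipschitz constant by [E b]; iterates become
   constant, hence the integral of such a function is the same for all fixed
   points of a given mass.  Lipschitz ramps approximate indicators of
   {m : m(l) >= x for finitely many (l, x)}, a generating pi-system. *)

(** * Random affine maps on the space of measures *)

Lemma measurable_mconf_eval {R : realType} {S : pointedType} (l : S) :
  measurable_fun [set: mconf R S] (fun m : mconf R S => m l).
Proof.
by move=> _ B mB; rewrite setTI; apply: sub_sigma_algebra; exists l, B.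
Qed.

Lemma measurable_fun_mconf {R : realType} {S : pointedType} {d}
    {T : measurableType d} (f : T -> mconf R S) :
  (forall l, measurable_fun [set: T] (fun t => f t l)) ->
  measurable_fun [set: T] f.
Proof.
move=> mf; apply: (@measurability _ _ T (mconf R S) setT f (@cyl_gen R S) erefl).
by move=> _ [_ [l [B [mB ->]]] <-]; exact: mf.
Qed.

(** Concatenating lists intersects the events, so they form a pi-system. *)
Definition above {R : realType} {S : pointedType} (L : seq (S * R)) :
  set (mconf R S) := [set m | forall p, p \in L -> p.2 <= m p.1].

Lemma aboveE {R : realType} {S : pointedType} (L : seq (S * R)) :
  above L = \bigcap_(p in [set` L]) [set m : mconf R S | p.2 <= m p.1].
Proof. by apply/seteqP; split => m /= Lm p /= /Lm. Qed.

Lemma measurable_above {R : realType} {S : pointedType} (L : seq (S * R)) :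
  measurable (above L).
Proof.
rewrite aboveE; apply: fin_bigcap_measurable => // p _.
have -> : [set m : mconf R S | p.2 <= m p.1] =
    [set: mconf R S] `&` (fun m : mconf R S => m p.1) @^-1` `[p.2, +oo[.
  by rewrite setTI; apply/seteqP; split => m /=; rewrite in_itv /= andbT.
exact: measurable_mconf_eval.
Qed.

(** Rays [[x, +oo[] generate the Borel sets, so one-element lists already generate the cylinder
    sigma-algebra. *)
Lemma mconf_measure_unique {R : realType} {S : pointedType}
    (m1 m2 : {finite_measure set (mconf R S) -> \bar R}) :
  (forall L, m1 (above L) = m2 (above L)) ->
  forall B, measurable B -> m1 B = m2 B.
Proof.
move=> m12; apply: (measure_unique (range above) (fun=> setT)) => //.
- apply/seteqP; split; apply: smallest_sub.
  + exact: smallest_sigma_algebra.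
  + move=> _ [l [B [mB ->]]].
    have ev : measurable_fun [set: g_sigma_algebraType (range (@above R S))]
        (fun m => m l).
      apply: (measurability _ (RGenCInfty.measurableE R)).
      move=> _ [_ [x ->] <-]; rewrite setTI; apply: sub_sigma_algebra.
      exists [:: (l, x)] => //; apply/seteqP; split => m /=.
        by move=> Lm; rewrite in_itv /= andbT; apply: (Lm (l, x)); rewrite inE.
      by rewrite in_itv /= andbT => xm p; rewrite inE => /eqP ->.
    by have := ev measurableT _ mB; rewrite setTI.
  + exact: sigma_algebra_measurable.
  + by move=> _ [L _ <-]; exact: measurable_above.
- move=> _ _ [L1 _ <-] [L2 _ <-]; exists (L1 ++ L2) => //.
  apply/seteqP; split => [m Lm|m [L1m L2m] p].
    by split=> p pL; apply: Lm; rewrite mem_cat pL ?orbT.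
  by rewrite mem_cat => /orP[/L1m|/L2m].
- by move=> _; exists [::] => //; apply/seteqP; split.
- by rewrite bigcup_const //; exists 0%N.
- by move=> _ [L _ <-]; exact: m12.
- by move=> _; rewrite -ge0_fin_numE // fin_num_measure.
Qed.

(** * Uniqueness of the invariant measure of a random affine map contracting on average *)

Section affine_fixed_point.
Context {R : realType} {d : measure_display} {Omega : measurableType d}.
Context (P : probability Omega R) {S : pointedType}.
Context (b : Omega -> R) (c : Omega -> S -> R).
Hypothesis mb : measurable_fun [set: Omega] b.
Hypothesis mc : forall l, measurable_fun [set: Omega] (fun w => c w l).
Hypothesis b01 : forall w, 0 <= b w <= 1.
Hypothesis b_lt1 : (\int[P]_w (b w)%:E < 1)%E.

Definition aff (p : Omega * mconf R S) : mconf R S :=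
  fun l => c p.1 l + b p.1 * p.2 l.

Lemma measurable_aff : measurable_fun [set: Omega * mconf R S] aff.
Proof.
apply: measurable_fun_mconf => l; apply: measurable_funD.
  exact: (measurableT_comp (mc l)).
apply: measurable_funM; first exact: (measurableT_comp mb).
exact: (measurableT_comp (measurable_mconf_eval l)).
Qed.

Let q : R := fine (\int[P]_w (b w)%:E)%E.

Let qE : (q%:E = \int[P]_w (b w)%:E)%E.
Proof.
rewrite fineK // ge0_fin_numE.
  by rewrite (lt_le_trans b_lt1) // leey.
by apply: integral_ge0 => w _; rewrite lee_fin; case/andP: (b01 w).
Qed.

Let q_ge0 : 0 <= q.
Proof.
by rewrite -lee_fin qE integral_ge0 // => w _; rewrite lee_fin; case/andP: (b01 w).
Qed.

Let q_lt1 : q < 1. Proof. by rewrite -lte_fin qE. Qed.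

(** The transition operator of the random iteration [m -> aff (w, m)], acting on functions. *)
Definition avg (g : mconf R S -> R) (m : mconf R S) : R :=
  fine (\int[P]_w (g (aff (w, m)))%:E)%E.

Definition unit_fun (g : mconf R S -> R) : Prop :=
  measurable_fun [set: mconf R S] g /\ forall m, 0 <= g m <= 1.

(** A pseudo-distance that sees only the coordinates listed in [L]; each map [aff (w, _)] scales it
    by exactly [b w]. *)
Definition dist (L : seq (S * R)) (m m' : mconf R S) : R :=
  \sum_(p <- L) `|m p.1 - m' p.1|.

Lemma dist_ge0 L m m' : 0 <= dist L m m'.
Proof. by apply: sumr_ge0. Qed.

Lemma dist_aff L w m m' :
  dist L (aff (w, m)) (aff (w, m')) = b w * dist L m m'.
Proof.
rewrite /dist mulr_sumr; apply: eq_bigr => p _ /=.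
rewrite /aff /= opprD addrACA subrr add0r -mulrBr normrM ger0_norm //.
by case/andP: (b01 w).
Qed.

Let mg2 {g} : unit_fun g ->
  measurable_fun [set: Omega * mconf R S] (fun p => (g (aff p))%:E).
Proof.
move=> [mg _]; apply/measurable_EFinP.
exact: (measurableT_comp mg measurable_aff).
Qed.

Let mg1 {g} m : unit_fun g ->
  measurable_fun [set: Omega] (fun w => (g (aff (w, m)))%:E).
Proof.
by move=> ug; apply: (measurableT_comp (mg2 ug)); exact: measurable_pair2.
Qed.

Let int_cst1 : (\int[P]_w (cst 1%E) w = 1)%E.
Proof. by rewrite integral_cst // mul1e; exact: probability_setT. Qed.

Lemma avgE g m : unit_fun g -> ((avg g m)%:E = \int[P]_w (g (aff (w, m)))%:E)%E.
Proof.
move=> ug; rewrite /avg fineK // ge0_fin_numE; last first.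
  by apply: integral_ge0 => w _; rewrite lee_fin; case/andP: (ug.2 (aff (w, m))).
apply: (@le_lt_trans _ _ (\int[P]_w (cst 1%E) w)%E); last first.
  by rewrite int_cst1 ltry.
apply: ge0_le_integral => //.
- by move=> w _; rewrite lee_fin; case/andP: (ug.2 (aff (w, m))).
- exact: mg1.
- by move=> w _; rewrite lee_fin; case/andP: (ug.2 (aff (w, m))).
Qed.

Lemma unit_fun_avg g : unit_fun g -> unit_fun (avg g).
Proof.
move=> ug; split.
  apply/measurable_EFinP; rewrite (_ : _ \o _ = fubini_G P (fun p => (g (aff p))%:E)).
    apply: measurable_fun_fubini_tonelli_G; first exact: mg2.
    by move=> p; rewrite lee_fin; case/andP: (ug.2 (aff p)).
  by apply/funext => m /=; rewrite avgE.
move=> m; rewrite -!lee_fin avgE //; apply/andP; split.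
  by apply: integral_ge0 => w _; rewrite lee_fin; case/andP: (ug.2 (aff (w, m))).
apply: (@le_trans _ _ (\int[P]_w (cst 1%E) w)%E); last first.
  by rewrite int_cst1.
apply: ge0_le_integral => //.
- by move=> w _; rewrite lee_fin; case/andP: (ug.2 (aff (w, m))).
- exact: mg1.
- by move=> w _; rewrite lee_fin; case/andP: (ug.2 (aff (w, m))).
Qed.

(** Comparing both points along the same [w] and integrating replaces the factor [b w] by its mean
    [q]. Quantifying over ordered pairs makes the one-sided inequality a two-sided bound. *)
Lemma avg_lip L g C : unit_fun g -> 0 <= C ->
  (forall m m', g m <= g m' + C * dist L m m') ->
  forall m m', avg g m <= avg g m' + C * q * dist L m m'.
Proof.
move=> ug C0 gl m m'.
have D0 := dist_ge0 L m m'.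
have mbE : measurable_fun [set: Omega] (fun w => (b w)%:E) by exact/measurable_EFinP.
rewrite -lee_fin EFinD mulrAC EFinM !avgE // qE -ge0_integralZl //; last 2 first.
- by move=> w _; rewrite lee_fin; case/andP: (b01 w).
- by rewrite lee_fin mulr_ge0.
rewrite -ge0_integralD //; last 4 first.
- by move=> w _; rewrite lee_fin; case/andP: (ug.2 (aff (w, m'))).
- exact: mg1.
- by move=> w _; rewrite -EFinM lee_fin !mulr_ge0 //; case/andP: (b01 w).
- exact: measurable_funeM.
apply: ge0_le_integral => //.
- by move=> w _; rewrite lee_fin; case/andP: (ug.2 (aff (w, m))).
- exact: mg1.
- by apply: emeasurable_funD; [exact: mg1|exact: measurable_funeM].
- move=> w _; rewrite -EFinM -EFinD lee_fin (le_trans (gl _ (aff (w, m')))) //.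
  by rewrite dist_aff lerD2l mulrCA (mulrC (b w)).
Qed.

Let it g n := iter n avg g.

Let unit_it g n : unit_fun g -> unit_fun (it g n).
Proof. by move=> ug; elim: n => //= n; exact: unit_fun_avg. Qed.

Let lip_it L g C n : unit_fun g -> 0 <= C ->
  (forall m m', g m <= g m' + C * dist L m m') ->
  forall m m', it g n m <= it g n m' + C * q ^+ n * dist L m m'.
Proof.
move=> ug C0 gl; elim: n => [|n IH] m m'; first by rewrite expr0 mulr1; exact: gl.
rewrite exprSr mulrA; apply: avg_lip => //; first exact: unit_it.
by rewrite mulr_ge0 // exprn_ge0.
Qed.

Let o : mconf R S := fun=> 0.

(** The gap is at most [C * dist L m o * q ^+ n], and [q < 1]. *)
Let it_cvg L g C m : unit_fun g -> 0 <= C ->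
  (forall m m', g m <= g m' + C * dist L m m') ->
  (fun n => it g n m - it g n o) @ \oo --> (0 : R).
Proof.
move=> ug C0 gl.
apply: norm_cvg0.
apply: (@squeeze_cvgr _ _ _ _ (cst 0) (fun n => C * dist L m o * q ^+ n)).
- near=> n; rewrite normr_ge0 /= ler_norml; apply/andP; split.
    rewrite lerBrDr addrC lerBlDr mulrAC.
    have := @lip_it L g C n ug C0 gl o m.
    rewrite [dist L o m](_ : _ = dist L m o) //.
    by rewrite /dist; apply: eq_bigr => p _; rewrite distrC.
  by rewrite lerBlDr addrC mulrAC; exact: (@lip_it L g C n ug C0 gl m o).
- exact: cvg_cst.
- rewrite -(mulr0 (C * dist L m o)); apply: cvgMr.
  by apply: cvg_expr; rewrite ger0_norm.
Unshelve. all: by end_near. Qed.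

(** The equation is homogeneous in [a], which makes it usable for unnormalised conditional laws. *)
Definition aff_invariant (a : set (mconf R S) -> \bar R) : Prop :=
  forall B, measurable B -> a B = (P \x a)%E (aff @^-1` B).

(** Invariance replaces [a] by the image of [P \x a] under [aff]; Tonelli then integrates out [w]
    first. *)
Lemma integral_avg (a : {finite_measure set (mconf R S) -> \bar R}) g :
  aff_invariant a -> unit_fun g ->
  (\int[a]_m (avg g m)%:E = \int[a]_m (g m)%:E)%E.
Proof.
move=> inv ug; have g0 m : (0 <= (g m)%:E)%E by rewrite lee_fin; case/andP: (ug.2 m).
rewrite [RHS](eq_measure_integral (pushforward (P \x a)%E aff)).
- exact: measurable_aff.
- move=> mA.
  rewrite ge0_integral_pushforward //; last first.
    by apply/measurable_EFinP; exact: ug.1.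
  rewrite preimage_setT (fubini_tonelli2 (fun p => (g (aff p))%:E)) //.
    by apply: eq_integral => m _; rewrite avgE.
  exact: mg2.
- by move=> mA B mB _; rewrite [LHS]inv.
Qed.

(** Repeating [integral_avg] removes the iterates, so that [a] enters only through its mass and the
    integral of [g]. *)
Let integral_centered (a : {finite_measure set (mconf R S) -> \bar R}) g n :
  aff_invariant a -> unit_fun g ->
  (\int[a]_m (it g n m - it g n o)%:E =
   (fine (\int[a]_m (g m)%:E) - it g n o * fine (a [set: mconf R S]))%:E)%E.
Proof.
move=> inv ug.
have aT : a [set: mconf R S] \is a fin_num by exact: fin_num_measure.
have itg h : unit_fun h -> a.-integrable [set: mconf R S] (EFin \o h).
  move=> uh; apply: (le_integrable _ _ _ (finite_measure_integrable_cst a 1 measurableT)) => //.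
    by apply/measurable_EFinP; exact: uh.1.
  move=> m _ /=; have /andP[h0 h1] := uh.2 m.
  by rewrite lee_fin normr1 ger0_norm.
have itE : (\int[a]_m (it g n m)%:E = \int[a]_m (g m)%:E)%E.
  elim: n => //= n <-; rewrite integral_avg //.
  exact: unit_it.
under eq_integral do rewrite EFinB.
rewrite integralB_EFin //; last 2 first.
- by apply: itg; exact: unit_it.
- exact: finite_measure_integrable_cst.
rewrite integral_cst // itE EFinB EFinM !fineK //.
by apply: integrable_fin_num => //; exact: itg.
Qed.

(** The centered iterates tend to 0 pointwise and stay in [-1,1], so dominated convergence applies
    even though [dist L m o] may be unbounded in [m]. *)
Let integral_centered_cvg (a : {finite_measure set (mconf R S) -> \bar R}) L g C :
  unit_fun g -> 0 <= C ->
  (forall m m', g m <= g m' + C * dist L m m') ->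
  (fun n => \int[a]_m (it g n m - it g n o)%:E)%E @ \oo --> 0%E.
Proof.
move=> ug C0 gl.
have mit n : measurable_fun [set: mconf R S] (it g n) by exact: (unit_it g n ug).1.
rewrite -[X in _ --> X](@integral0 _ _ _ a [set: mconf R S]).
have [] // := @dominated_convergence _ _ _ a [set: mconf R S] measurableT
  (fun n m => (it g n m - it g n o)%:E) (cst 0%E) (EFin \o cst 1).
- by move=> n; apply/measurable_EFinP; exact: measurable_funB.
- by apply: aeW => m _; apply: cvg_EFin; [near=> n|exact: (it_cvg L g C)].
- exact: finite_measure_integrable_cst.
- apply: aeW => m n _ /=; rewrite lee_fin ler_norml.
  have /andP[h0 h1] := (unit_it g n ug).2 m.
  have /andP[k0 k1] := (unit_it g n ug).2 o.
  by apply/andP; split; lra.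
Unshelve. all: by end_near. Qed.

(** As the masses agree, the difference of the two centered integrals does not depend on [n]: it is
    the difference of the integrals of [g]. It also tends to 0. *)
Let integral_lip_unique (a a' : {finite_measure set (mconf R S) -> \bar R}) L g C :
  aff_invariant a -> aff_invariant a' ->
  a [set: mconf R S] = a' [set: mconf R S] ->
  unit_fun g -> 0 <= C ->
  (forall m m', g m <= g m' + C * dist L m m') ->
  fine (\int[a]_m (g m)%:E)%E = fine (\int[a']_m (g m)%:E)%E.
Proof.
move=> inva inva' aa' ug C0 gl.
have /fine_cvg ca := integral_centered_cvg a L g C ug C0 gl.
have /fine_cvg ca' := integral_centered_cvg a' L g C ug C0 gl.
apply/eqP; rewrite -subr_eq0; apply/eqP.
have cc : (fun n => fine (\int[a]_m (it g n m - it g n o)%:E)%E -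
    fine (\int[a']_m (it g n m - it g n o)%:E)%E) @ \oo --> (0 : R).
  by rewrite -(subrr 0); exact: cvgB.
move: cc; rewrite (_ : (fun n => _) =
    cst (fine (\int[a]_m (g m)%:E)%E - fine (\int[a']_m (g m)%:E)%E)).
  by move=> /(cvg_lim (@norm_hausdorff _ _)) <-; rewrite lim_cst //; exact: norm_hausdorff.
apply/funext => n /=; rewrite !integral_centered // aa' /=.
by rewrite opprB addrA subrK.
Qed.

(** The sum measures how far [m] violates the constraints in [L]; the ramp is 1 without violation
    and falls off with slope [k]. *)
Let ramp (L : seq (S * R)) (k : nat) (m : mconf R S) : R :=
  Num.max 0 (1 - k%:R * \sum_(p <- L) Num.max 0 (p.2 - m p.1)).

Let defect_ge0 L (m : mconf R S) :
  0 <= \sum_(p <- L) Num.max 0 (p.2 - m p.1).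
Proof. by apply: sumr_ge0 => p _; rewrite le_max lexx. Qed.

Let unit_ramp L k : unit_fun (ramp L k).
Proof.
split.
  apply: measurable_maxr => //; apply: measurable_funB => //.
  apply: measurable_funM => //; apply: measurable_sum => p.
  apply: measurable_maxr => //; apply: measurable_funB => //.
  exact: measurable_mconf_eval.
move=> m; rewrite /ramp le_max lexx /= ge_max ler01 /= gerBl.
by rewrite mulr_ge0.
Qed.

Let lip_ramp L k m m' : ramp L k m <= ramp L k m' + k%:R * dist L m m'.
Proof.
have D0 : 0 <= k%:R * dist L m m' by rewrite mulr_ge0 // dist_ge0.
rewrite /ramp ge_max addr_ge0 ?le_max ?lexx //=.
rewrite -lerBlDr le_max; apply/orP; right.
rewrite lerBlDr -addrA lerD2l lerNl opprD opprK -mulrN -mulrDr.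
rewrite ler_wpM2l // lerBlDr /dist -big_split /= ler_sum // => p _.
rewrite ge_max addr_ge0 ?le_max ?lexx //=.
have := ler_norm (m p.1 - m' p.1).
by case: (leP 0 (p.2 - m p.1)) => ? ?; lra.
Qed.

Let ramp_cvg L m : (ramp L ^~ m) @ \oo --> (\1_(above L) m : R).
Proof.
rewrite indicE; case: (boolP (m \in above L)) => [|/negP].
  rewrite inE => Lm; rewrite [X in X @ _](_ : _ = cst 1); first exact: cvg_cst.
  apply/funext => k; rewrite /ramp big_seq big1 ?mulr0 ?subr0.
    by rewrite /Num.max ltr01.
  by move=> p /Lm Lp; apply/max_idPl; rewrite subr_le0.
rewrite inE => nLm; set D := \sum_(p <- L) Num.max 0 (p.2 - m p.1).
have D0 : 0 < D.
  rewrite lt_neqAle defect_ge0 andbT eq_sym; apply/negP => /eqP D0.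
  apply: nLm => p pL.
  have := D0 => /eqP; rewrite /D psumr_eq0; last by move=> ? _; rewrite le_max lexx.
  move=> /allP/(_ _ pL)/= /eqP pm.
  by rewrite -subr_le0 -pm le_max lexx orbT.
(* Outside [above L] the ramp is 0 as soon as [k] reaches [D^-1]. *)
apply: cvg_near_cst; near=> k; rewrite /ramp -/D; apply/max_idPl.
rewrite subr_le0 -ler_pdivrMr // mul1r.
near: k; exact: nbhs_infty_ger.
Unshelve. all: by end_near. Qed.

Lemma aff_invariant_unique (a a' : {finite_measure set (mconf R S) -> \bar R}) :
  aff_invariant a -> aff_invariant a' ->
  a [set: mconf R S] = a' [set: mconf R S] ->
  forall B, measurable B -> a B = a' B.
Proof.
move=> inva inva' aa'; apply: mconf_measure_unique => L.
have rampc (a0 : {finite_measure set (mconf R S) -> \bar R}) :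
    (fun k => \int[a0]_m (ramp L k m)%:E)%E @ \oo --> a0 (above L).
  rewrite -[above L]setIT -integral_indic ?setIT //; last exact: measurable_above.
  have [] // := @dominated_convergence _ _ _ a0 [set: mconf R S] measurableT
    (fun k m => (ramp L k m)%:E) (EFin \o \1_(above L)) (EFin \o cst 1).
  - by move=> k; apply/measurable_EFinP; exact: (unit_ramp L k).1.
  - by apply/measurable_EFinP; apply: measurable_indic; exact: measurable_above.
  - by apply: aeW => m _; apply: cvg_EFin; [near=> n|exact: ramp_cvg].
  - exact: finite_measure_integrable_cst.
  - apply: aeW => m k _ /=; rewrite lee_fin.
    by have /andP[h0 h1] := (unit_ramp L k).2 m; rewrite ger0_norm.
have fL (a0 : {finite_measure set (mconf R S) -> \bar R}) : a0 (above L) \is a fin_num.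
  by apply: fin_num_measure; exact: measurable_above.
rewrite -(fineK (fL a)) -(fineK (fL a')); congr (_%:E).
have ra : fine \o (fun k => \int[a]_m (ramp L k m)%:E)%E @ \oo --> fine (a (above L)).
  by apply: fine_cvg; rewrite fineK.
have ra' : fine \o (fun k => \int[a']_m (ramp L k m)%:E)%E @ \oo --> fine (a' (above L)).
  by apply: fine_cvg; rewrite fineK.
have rr' : (fine \o (fun k => \int[a]_m (ramp L k m)%:E)%E) =
    (fine \o (fun k => \int[a']_m (ramp L k m)%:E)%E).
  apply/funext => k; exact: (integral_lip_unique a a' L (ramp L k) k%:R inva inva'
    aa' (unit_ramp L k) (ler0n _ _) (lip_ramp L k)).
move: ra; rewrite rr' => ra.
exact: (cvg_unique (@norm_hausdorff _ _) ra ra').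
Unshelve. all: by end_near. Qed.

End affine_fixed_point.

(** * Stick breaking and splicing at the first return *)

Section stick_breaking.
Set Implicit Arguments.
Unset Strict Implicit.
Context {R : realType} {d : measure_display} {Omega : measurableType d}.
Context {S : pointedType}.
Implicit Types (X : nat -> Omega -> R) (T : nat -> Omega -> S) (w : Omega).

Lemma sum_stick X w n :
  \sum_(j < n) stick X j w = 1 - \prod_(j < n) (1 - X j w).
Proof.
elim: n => [|n IH]; first by rewrite !big_ord0 subrr.
rewrite !big_ord_recr /= IH /stick; ring.
Qed.

Lemma stick_ge0 X w j : (forall j, 0 <= X j w <= 1) -> 0 <= stick X j w.
Proof.
move=> X01; apply: mulr_ge0; first by case/andP: (X01 j).
by apply: prodr_ge0 => i _; rewrite subr_ge0; case/andP: (X01 i).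
Qed.

Lemma sum_stick_le1 X w n : (forall j, 0 <= X j w <= 1) ->
  \sum_(j < n) stick X j w <= 1.
Proof.
move=> X01; rewrite sum_stick gerBl.
by apply: prodr_ge0 => i _; rewrite subr_ge0; case/andP: (X01 i).
Qed.

(** The partial sums increase and are bounded by the total stick mass. Hence the [limn] in the
    definitions are genuine limits at every sample point, not just almost surely. *)
Lemma is_cvg_stick X w (a : nat -> R) : (forall j, 0 <= X j w <= 1) ->
  (forall j, 0 <= a j <= 1) ->
  cvgn (fun n => \sum_(j < n) a j * stick X j w).
Proof.
move=> X01 a01; apply: nondecreasing_is_cvgn.
  move=> m n mn; rewrite -[leLHS](big_mkord xpredT (fun j => a j * stick X j w)).
  rewrite -[leRHS](big_mkord xpredT (fun j => a j * stick X j w)).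
  rewrite [leRHS](@big_cat_nat _ _ _ m) //= lerDl; apply: sumr_ge0 => j _.
  by rewrite mulr_ge0 ?stick_ge0 //; case/andP: (a01 j).
exists 1 => _ [n _ <-]; apply: le_trans (sum_stick_le1 n X01).
apply: ler_sum => j _; apply: ler_piMl; first exact: stick_ge0.
by case/andP: (a01 j).
Qed.

Lemma is_cvg_ram X T w l : (forall j, 0 <= X j w <= 1) ->
  cvgn (fun n => \sum_(j < n) stick X j w * (T j w == l)%:R).
Proof.
move=> X01.
rewrite (_ : (fun n => _) = fun n => \sum_(j < n) (T j w == l)%:R * stick X j w).
  apply: (@is_cvg_stick X w (fun j => (T j w == l)%:R)) => // j.
  by case: eqP; rewrite /= ?lexx ?ler01.
by apply/funext => n; apply: eq_bigr => j _; rewrite mulrC.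
Qed.

Lemma exc_ind01 T i j w : 0 <= exc_ind (R := R) T i j w <= 1.
Proof.
rewrite /exc_ind; elim/big_ind: _ => [|x y /andP[x0 x1] /andP[y0 y1]|k _].
- by rewrite ler01 lexx.
- by rewrite mulr_ge0 // mulr_ile1.
- by case: eqP; rewrite /= ?lexx ?ler01.
Qed.

Lemma is_cvg_exc_mass X T i w : (forall j, 0 <= X j w <= 1) ->
  cvgn (fun n => \sum_(j < n) exc_ind T i j w * stick X j w).
Proof.
by move=> X01; apply: (@is_cvg_stick X w (exc_ind T i ^~ w)) => // j; exact: exc_ind01.
Qed.

(** This is [X^i eta^i] before normalisation, which avoids dividing by an excursion mass that may
    vanish. *)
Definition exc_part X T i w (l : S) : R :=
  limn (fun n => \sum_(j < n) exc_ind T i j w * stick X j w * (T j w == l)%:R).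

Lemma is_cvg_exc_part X T i w l : (forall j, 0 <= X j w <= 1) ->
  cvgn (fun n => \sum_(j < n) exc_ind T i j w * stick X j w * (T j w == l)%:R).
Proof.
move=> X01.
rewrite (_ : (fun n => _) = fun n =>
    \sum_(j < n) (exc_ind T i j w * (T j w == l)%:R) * stick X j w).
  apply: (@is_cvg_stick X w (fun j => exc_ind T i j w * (T j w == l)%:R)) => // j.
  have /andP[e0 e1] := exc_ind01 T i j w.
  by case: eqP => _; rewrite ?mulr1 ?mulr0 ?e0 ?e1 ?lexx ?ler01.
by apply/funext => n; apply: eq_bigr => j _; rewrite mulrAC.
Qed.

(** The term [j = 0] always belongs to the excursion. The bound serves to make the mean of
    [1 - exc_mass] smaller than 1. *)
Lemma exc_mass_ge X T i w : (forall j, 0 <= X j w <= 1) ->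
  X 0%N w <= exc_mass X T i w.
Proof.
move=> X01; apply: limr_ge; first exact: is_cvg_exc_mass.
near=> n; have n0 : (0 < n)%N by near: n; exact: nbhs_infty_gt.
rewrite -(prednK n0) big_ord_recl /= /exc_ind big_geq // mul1r.
rewrite /stick big_ord0 mulr1 lerDl; apply: sumr_ge0 => j _.
by rewrite mulr_ge0 ?stick_ge0 //; case/andP: (exc_ind01 T i (bump 0 j) w).
Unshelve. all: by end_near. Qed.

Lemma exc_mass01 X T i w : (forall j, 0 <= X j w <= 1) ->
  0 <= exc_mass X T i w <= 1.
Proof.
move=> X01; apply/andP; split.
  by apply: le_trans (exc_mass_ge T i X01); case/andP: (X01 0%N).
apply: limr_le; first exact: is_cvg_exc_mass.
near=> n; apply: le_trans (sum_stick_le1 n X01).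
apply: ler_sum => j _; apply: ler_piMl; first exact: stick_ge0.
by case/andP: (exc_ind01 T i j w).
Unshelve. all: by end_near. Qed.

Lemma exc_part_bound X T i w l : (forall j, 0 <= X j w <= 1) ->
  0 <= exc_part X T i w l <= exc_mass X T i w.
Proof.
move=> X01.
have F0 j : 0 <= exc_ind T i j w * stick X j w.
  by rewrite mulr_ge0 ?stick_ge0 //; case/andP: (exc_ind01 T i j w).
apply/andP; split.
  apply: limr_ge; first exact: is_cvg_exc_part.
  by near=> n; apply: sumr_ge0 => j _; rewrite mulr_ge0.
apply: ler_lim; [exact: is_cvg_exc_part|exact: is_cvg_exc_mass|].
near=> n; apply: ler_sum => j _; apply: ler_piMr => //.
by case: eqP; rewrite /= ?lexx ?ler01.
Unshelve. all: by end_near. Qed.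

(* When [exc_mass] vanishes, [exc_eta] is the junk value [0^-1 * 0], and both
   sides reduce to [m l]. *)
Lemma mix_excE X T i w (m : S -> R) l : (forall j, 0 <= X j w <= 1) ->
  mix (exc_mass X T i w) (exc_eta X T i w) m l =
  exc_part X T i w l + (1 - exc_mass X T i w) * m l.
Proof.
move=> X01; rewrite /mix /exc_eta -/(exc_part X T i w l).
have [e0|e0] := eqVneq (exc_mass X T i w) 0; last by rewrite mulVKf.
have := exc_part_bound T i l X01; rewrite e0 => /le_anti <-.
by rewrite !mulr0.
Qed.

End stick_breaking.

(** * Splicing deterministic paths *)

Section splice.
Set Implicit Arguments.
Unset Strict Implicit.
Context {S : pointedType}.
Implicit Types (t u s : nat -> S) (i : S).

(** A relation rather than a function of the path, so that paths without return need no default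
    time. *)
Definition first_ret t i (k : nat) : bool :=
  [&& (0 < k)%N, t k == i & [forall l : 'I_k, (0 < l)%N ==> (t l != i)]].

Lemma first_ret_inj t i k k' : first_ret t i k -> first_ret t i k' -> k = k'.
Proof.
move=> /and3P[k0 tk /forallP nk] /and3P[k0' tk' /forallP nk'].
case: (ltngtP k k') => // kk'.
  by have := nk' (Ordinal kk'); rewrite /= k0 tk.
by have := nk (Ordinal kk'); rewrite /= k0' tk'.
Qed.

Lemma eq_first_ret t s i k : (forall j, (j <= k)%N -> t j = s j) ->
  first_ret t i k = first_ret s i k.
Proof.
move=> ts; rewrite /first_ret ts //; congr [&& _, _ & _].
by apply: eq_forallb => l; rewrite ts // ltnW.
Qed.

(** With ['I_j.+1] a return at time [j] itself counts: the fraction at the return time is already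
    the first of the new sequence. *)
Definition splice_frac {V : Type} t i (x y : nat -> V) (j : nat) : V :=
  if [pick k : 'I_j.+1 | first_ret t i k] is Some k then y (j - k)%N else x j.

(* The state at the return time itself is read off the first chain. *)
Definition splice_chain t i u (j : nat) : S :=
  if [pick k : 'I_j | first_ret t i k] is Some k then u (j - k)%N else t j.

Lemma splice_frac_before {V : Type} t i (x y : nat -> V) j :
  (forall k, (k <= j)%N -> ~~ first_ret t i k) -> splice_frac t i x y j = x j.
Proof.
move=> nr; rewrite /splice_frac; case: pickP => // k.
by rewrite (negbTE (nr _ _)) // -ltnS.
Qed.

Lemma splice_frac_after {V : Type} t i (x y : nat -> V) j k :
  first_ret t i k -> (k <= j)%N -> splice_frac t i x y j = y (j - k)%N.
Proof.
move=> rk kj; rewrite /splice_frac; case: pickP => [k' rk'|].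
  by rewrite (first_ret_inj rk rk').
by move=> /(_ (Ordinal (kj : (k < j.+1)%N))); rewrite /= rk.
Qed.

Lemma splice_chain_before t i u j :
  (forall k, (k < j)%N -> ~~ first_ret t i k) -> splice_chain t i u j = t j.
Proof.
move=> nr; rewrite /splice_chain; case: pickP => // k.
by rewrite (negbTE (nr _ _)).
Qed.

Lemma splice_chain_after t i u j k :
  first_ret t i k -> (k < j)%N -> splice_chain t i u j = u (j - k)%N.
Proof.
move=> rk kj; rewrite /splice_chain; case: pickP => [k' rk'|].
  by rewrite (first_ret_inj rk rk').
by move=> /(_ (Ordinal kj)); rewrite /= rk.
Qed.

Lemma splice_frac_lt {V : Type} t i (x y : nat -> V) j k :
  first_ret t i k -> (j < k)%N -> splice_frac t i x y j = x j.
Proof.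
move=> rk jk; apply: splice_frac_before => m mj; apply/negP => rm.
by move: (leq_ltn_trans mj jk); rewrite (first_ret_inj rm rk) ltnn.
Qed.

Lemma splice_chain_le t i u j k :
  first_ret t i k -> (j <= k)%N -> splice_chain t i u j = t j.
Proof.
move=> rk jk; apply: splice_chain_before => m mj; apply/negP => rm.
by move: (leq_trans mj jk); rewrite (first_ret_inj rm rk) ltnn.
Qed.

(** The splicing time is read off [t], while only the returns of [s] are controlled. Strong
    induction breaks the circle: agreement below [j] rules out a return of [t] before [j], so the
    spliced chain still reads [t j]. *)
Lemma splice_chain_prefix t i u s n m :
  (forall j, (j < n)%N -> splice_chain t i u j = s j) ->
  (forall k, (k < m)%N -> ~~ first_ret s i k) ->
  forall j, (j < n)%N -> (j <= m)%N -> t j = s j.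
Proof.
move=> ts nr; elim/ltn_ind => j IH jn jm.
rewrite -ts // splice_chain_before // => k kj.
rewrite (eq_first_ret (s := s)); first by apply: nr; exact: leq_trans kj jm.
move=> l lk; have lj := leq_ltn_trans lk kj.
by apply: IH => //; [exact: ltn_trans lj jn|exact: leq_trans (ltnW lj) jm].
Qed.

End splice.

(** * Measurability of the random sums *)

Section measurable_processes.
Set Implicit Arguments.
Unset Strict Implicit.
Context {R : realType} {d : measure_display} {Omega : measurableType d}.
Context {S : pointedType} (X : nat -> Omega -> R) (T : nat -> Omega -> S).
Hypothesis mX : forall j, measurable_fun [set: Omega] (X j).
Hypothesis X01 : forall j w, 0 <= X j w <= 1.
Hypothesis mT : forall n s, measurable (T n @^-1` [set s]).

Lemma measurable_state_ind j l :
  measurable_fun [set: Omega] (fun w => (T j w == l)%:R : R).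
Proof.
rewrite (_ : (fun w => _) = \1_(T j @^-1` [set l])); first exact: measurable_indic.
apply/funext => w; rewrite indicE; congr (nat_of_bool _)%:R.
by apply/eqP/idP; rewrite inE.
Qed.

Lemma measurable_stick j : measurable_fun [set: Omega] (stick X j).
Proof.
apply: measurable_funM => //; apply: measurable_prod => i _.
exact: measurable_funB.
Qed.

Lemma measurable_exc_ind i j : measurable_fun [set: Omega] (exc_ind (R := R) T i j).
Proof.
apply: measurable_prod => k _.
rewrite (_ : (fun w => _) = fun w => 1 - (T k w == i)%:R).
  by apply: measurable_funB => //; exact: measurable_state_ind.
by apply/funext => w; case: eqP; rewrite ?subrr ?subr0.
Qed.

Lemma measurable_exc_mass i : measurable_fun [set: Omega] (exc_mass X T i).
Proof.
apply: (@measurable_fun_cvg _ _ _ _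
  (fun n w => \sum_(j < n) exc_ind T i j w * stick X j w)) => [n|w _]; last first.
  exact: is_cvg_exc_mass.
apply: measurable_sum => j.
by apply: measurable_funM; [exact: measurable_exc_ind|exact: measurable_stick].
Qed.

Lemma measurable_exc_part i l :
  measurable_fun [set: Omega] (fun w => exc_part X T i w l).
Proof.
apply: (@measurable_fun_cvg _ _ _ _ (fun n w =>
  \sum_(j < n) exc_ind T i j w * stick X j w * (T j w == l)%:R)) => [n|w _]; last first.
  exact: is_cvg_exc_part.
apply: measurable_sum => j; apply: measurable_funM; last exact: measurable_state_ind.
by apply: measurable_funM; [exact: measurable_exc_ind|exact: measurable_stick].
Qed.

Lemma measurable_ram : measurable_fun [set: Omega] (ram_measure X T).
Proof.
apply: measurable_fun_mconf => l.
apply: (@measurable_fun_cvg _ _ _ _ (fun n w =>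
  \sum_(j < n) stick X j w * (T j w == l)%:R)) => [n|w _]; last first.
  exact: is_cvg_ram.
apply: measurable_sum => j.
by apply: measurable_funM; [exact: measurable_stick|exact: measurable_state_ind].
Qed.

Lemma measurable_cyl_X n (A : nat -> set R) : (forall j, measurable (A j)) ->
  measurable (cyl_X X n A).
Proof.
move=> mA; apply: bigcap_measurableType => j _.
by have := mX j measurableT (mA j); rewrite setTI.
Qed.

Lemma measurable_cyl_T n (s : nat -> S) : measurable (cyl_T T n s).
Proof. by apply: bigcap_measurableType => j _. Qed.

End measurable_processes.

Lemma eq_ram_measure {R : realType} {d d' : measure_display}
    {O1 : measurableType d} {O2 : measurableType d'} {S : pointedType}
    (X : nat -> O1 -> R) (T : nat -> O1 -> S) (X' : nat -> O2 -> R) (T' : nat -> O2 -> S)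
    w w' :
  (forall j, X j w = X' j w') -> (forall j, T j w = T' j w') ->
  ram_measure X T w = ram_measure X' T' w'.
Proof.
move=> XX TT; apply/funext => l; rewrite /ram_measure.
congr (limn _); apply/funext => n; apply: eq_bigr => j _.
rewrite TT /stick XX; congr (_ * _ * _).
by apply: eq_bigr => k _; rewrite XX.
Qed.

(** Coding states by integers, with a total decoder, turns sums and unions over [S] into ones over
    [nat]. *)
Lemma countable_cancel {S : pointedType} : countable [set: S] ->
  exists (e : S -> nat) (g : nat -> S), cancel e g.
Proof.
move=> /countable_injP[f finj].
exists f, (fun n => if pselect (exists s, f s = n) is left h then projT1 (cid h) else point).
move=> s; case: pselect => [h|]; last by case; exists s.
by apply: finj; rewrite ?inE //; exact: (projT2 (cid h)).
Qed.

(** * Path space *)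

Section path_space.
Set Implicit Arguments.
Unset Strict Implicit.
Context {R : realType} {S : pointedType}.

Definition path_cyl n (A : nat -> set R) (s : nat -> S) : set (nat -> R * S) :=
  [set z | forall j, (j < n)%N -> A j (z j).1 /\ (z j).2 = s j].

(** Cylinders with conflicting states are disjoint, so the empty set is added to obtain closure
    under intersection. *)
Definition path_gen : set (set (nat -> R * S)) :=
  [set C | C = set0 \/ exists n A s, (forall j, measurable (A j)) /\ C = path_cyl n A s].

Definition pathsp : Type := g_sigma_algebraType path_gen.

Lemma measurable_path_cyl n A s : (forall j, measurable (A j)) ->
  measurable (path_cyl n A s : set pathsp).
Proof. by move=> mA; apply: sub_sigma_algebra; right; exists n, A, s. Qed.

Lemma path_gen_setI : setI_closed path_gen.
Proof.
move=> C C' [->|[n [A [s [mA ->]]]]]; first by rewrite set0I; left.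
move=> [->|[n' [A' [s' [mA' ->]]]]]; first by rewrite setI0; left.
have [ss'|nss'] := pselect (forall j, (j < n)%N -> (j < n')%N -> s j = s' j); last first.
  left; apply/seteqP; split => // z [zC zC']; apply: nss' => j jn jn'.
  by rewrite -(zC j jn).2 -(zC' j jn').2.
right; exists (maxn n n'),
  (fun j => (if (j < n)%N then A j else setT) `&` (if (j < n')%N then A' j else setT)),
  (fun j => if (j < n)%N then s j else s' j); split.
  by move=> j; apply: measurableI; case: ifP.
apply/seteqP; split => [z [zC zC'] j|z zC].
  rewrite leq_max => jnn'; split.
    split; case: ifP => // jn; [exact: (zC j jn).1|exact: (zC' j jn).1].
  case: ifP jnn' => [jn _|jn /= jn']; [exact: (zC j jn).2|exact: (zC' j jn').2].
split=> j jn.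
  have [|+ ->] := zC j; first by rewrite leq_max jn.
  by rewrite jn => -[].
have [|+ ->] := zC j; first by rewrite leq_max jn orbT.
by rewrite jn => -[_ ?]; split => //; case: ifP => // jn'; rewrite ss'.
Qed.

Lemma path_measure_unique (m1 m2 : {measure set pathsp -> \bar R}) :
  (m1 [set: pathsp] < +oo)%E ->
  (forall n A s, (forall j, measurable (A j)) ->
     m1 (path_cyl n A s) = m2 (path_cyl n A s)) ->
  forall B, measurable B -> m1 B = m2 B.
Proof.
move=> m1oo m12; apply: (@measure_unique _ R pathsp path_gen (fun=> setT) erefl) => //.
- exact: path_gen_setI.
- move=> _; right; exists 0%N, (fun=> setT), (fun=> point); split => //.
  by apply/seteqP; split.
- by rewrite bigcup_const //; exists 0%N.
- by move=> C [->|[n [A [s [mA ->]]]]]; [rewrite !measure0|exact: m12].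
Qed.

Lemma measurable_fun_pathsp {d} {T : measurableType d} (f : T -> pathsp) :
  (forall n A s, (forall j, measurable (A j)) -> measurable (f @^-1` path_cyl n A s)) ->
  measurable_fun [set: T] f.
Proof.
move=> mf; apply: (@measurability _ _ T pathsp setT f path_gen erefl).
move=> _ [C [->|[n [A [s [mA ->]]]]] <-]; rewrite setTI; last exact: mf.
by rewrite preimage_set0.
Qed.

Hypothesis cS : countable [set: S].

Lemma measurable_path_coord j (B : set R) (C : set S) : measurable B ->
  measurable ([set z | B (z j).1 /\ C (z j).2] : set pathsp).
Proof.
move=> mB; have [f [g fK]] := countable_cancel cS.
pose A k := if k == j then B else setT.
have mA k : measurable (A k) by rewrite /A; case: ifP.
(* A cylinder prescribes all states up to time [j], so the event is split over the countably many
   coded prefixes [p] whose last state lies in [C]. *)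
pose U (p : seq nat) : set pathsp :=
  if `[< C (g (nth 0%N p j)) >] then path_cyl j.+1 A (fun k => g (nth 0%N p k)) else set0.
rewrite (_ : [set z | _] = \bigcup_p U p); last first.
  apply/seteqP; split => [z [zB zC]|z [p _]].
    exists (mkseq (fun k => f (z k).2) j.+1) => //.
    rewrite /U nth_mkseq // fK asboolT // => k kj.
    by rewrite nth_mkseq // fK /A; split => //; case: eqP => // ->.
  rewrite /U; case: asboolP => // Cp /(_ j (ltnSn j)).
  by rewrite /A eqxx => -[zB zs]; split => //=; rewrite zs.
apply: countable_bigcupT_measurable; first exact: countableP.
by move=> p; rewrite /U; case: ifP => // _; exact: measurable_path_cyl.
Qed.

(* Clipping makes the coordinate fractions [0,1]-valued on the whole path space. *)
Definition path_frac (j : nat) (z : pathsp) : R := Num.max 0 (Num.min 1 (z j).1).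
Definition path_state (j : nat) (z : pathsp) : S := (z j).2.

Lemma path_frac01 j z : 0 <= path_frac j z <= 1.
Proof. by rewrite /path_frac le_max lexx /= ge_max ler01 ge_min lexx. Qed.

Lemma path_frac_id j z : 0 <= (z j).1 <= 1 -> path_frac j z = (z j).1.
Proof. by move=> /andP[z0 z1]; rewrite /path_frac; rewrite (min_idPr z1) (max_idPr z0). Qed.

Lemma measurable_path_ram :
  measurable_fun [set: pathsp] (ram_measure path_frac path_state).
Proof.
apply: measurable_ram.
- move=> j; apply: measurable_maxr => //; apply: measurable_minr => //.
  move=> _ B mB; rewrite setTI.
  have := measurable_path_coord j setT mB.
  by congr measurable; apply/seteqP; split => z //= [].
- by move=> j z; exact: path_frac01.
- move=> j s; have := measurable_path_coord j [set s] (@measurableT _ R).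
  by congr measurable; apply/seteqP; split => z //= [].
Qed.

End path_space.

(** * The weighted occupation measure of a spliced path *)

Section splice_ram.
Set Implicit Arguments.
Unset Strict Implicit.
Context {R : realType} {d : measure_display} {Omega : measurableType d}.
Context {S : pointedType}.
Context (X : nat -> Omega -> R) (T Tr : nat -> Omega -> S) (i : S).
Hypothesis X01 : forall j w, 0 <= X j w <= 1.

Definition splice_X (j : nat) (p : Omega * Omega) : R :=
  splice_frac (Tr ^~ p.1) i (X ^~ p.1) (X ^~ p.2) j.
Definition splice_T (j : nat) (p : Omega * Omega) : S :=
  splice_chain (Tr ^~ p.1) i (T ^~ p.2) j.

Lemma exc_ind_first_ret w k j : first_ret (Tr ^~ w) i k ->
  exc_ind (R := R) Tr i j w = (j < k)%N%:R.
Proof.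
move=> /and3P[k0 tk /forallP nk]; rewrite /exc_ind; case: ltnP => [jk|kj].
  rewrite big_nat_cond big1 // => m /andP[/andP[m0 mj] _].
  have mk : (m < k)%N by exact: leq_trans mj jk.
  by have := nk (Ordinal mk); rewrite /= m0 /= => ->.
apply/eqP; rewrite prodf_seq_eq0; apply/hasP; exists k.
  by rewrite mem_index_iota k0 ltnS.
by apply/eqP; rewrite (eqP tk) eqxx.
Qed.

Lemma exc_sum_first_ret w k (a : nat -> R) : first_ret (Tr ^~ w) i k ->
  limn (fun n => \sum_(j < n) exc_ind Tr i j w * stick X j w * a j) =
  \sum_(j < k) stick X j w * a j.
Proof.
move=> rk; apply: lim_near_cst; first exact: norm_hausdorff.
near=> n; have kn : (k <= n)%N by near: n; exact: nbhs_infty_ge.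
rewrite -(subnKC kn) big_split_ord /= [X in _ + X]big1 ?addr0.
  by apply: eq_bigr => j _; rewrite (exc_ind_first_ret _ rk) /= ltn_ord mul1r.
by move=> j _; rewrite (exc_ind_first_ret _ rk) /= ltnNge leq_addr !mul0r.
Unshelve. all: by end_near. Qed.

(** Before the return the sticks are those of the excursion. From time [k] on they are the sticks of
    the second copy times [D], the length left after [k] breaks, which equals [1 - exc_mass]. *)
Lemma splice_ram (p : Omega * Omega) k : first_ret (Tr ^~ p.1) i k -> T 0%N p.2 = i ->
  ram_measure splice_X splice_T p =
  mix (exc_mass X Tr i p.1) (exc_eta X Tr i p.1) (ram_measure X T p.2).
Proof.
move=> rk T0; apply/funext => l; rewrite mix_excE; last by move=> j; exact: X01.
have Xlt j : (j < k)%N -> splice_X j p = X j p.1.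
  by move=> jk; rewrite /splice_X (splice_frac_lt _ _ rk jk).
have Xge j : splice_X (k + j) p = X j p.2.
  by rewrite /splice_X (splice_frac_after _ _ rk) ?leq_addr // addKn.
have Tlt j : (j <= k)%N -> splice_T j p = Tr j p.1.
  by move=> jk; rewrite /splice_T (splice_chain_le _ rk jk).
have Tge j : splice_T (k + j) p = T j p.2.
  (* At the return time the state is read off the first chain; both chains show [i] there. *)
  case: j => [|j]; last by rewrite /splice_T (splice_chain_after _ rk) ?addKn // -addSnnS leq_addr.
  by rewrite addn0 Tlt // T0; case/and3P: rk => _ /eqP.
have slt j : (j < k)%N -> stick splice_X j p = stick X j p.1.
  move=> jk; rewrite /stick Xlt //; congr (_ * _); apply: eq_bigr => m _.
  by rewrite Xlt // (ltn_trans _ jk).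
pose D := \prod_(j < k) (1 - X j p.1).
have sge j : stick splice_X (k + j) p = D * stick X j p.2.
  rewrite /stick Xge big_split_ord /= mulrCA; congr (_ * (_ * _)).
    by apply: eq_bigr => m _; rewrite Xlt.
  by apply: eq_bigr => m _; rewrite Xge.
have massE : exc_mass X Tr i p.1 = \sum_(j < k) stick X j p.1.
  rewrite /exc_mass; have := exc_sum_first_ret (fun=> 1) rk.
  under eq_fun do under eq_bigr do rewrite mulr1.
  by move=> ->; apply: eq_bigr => j _; rewrite mulr1.
rewrite /exc_part (exc_sum_first_ret (fun j => (Tr j p.1 == l)%:R) rk) massE sum_stick -/D.
rewrite subKr.
apply: cvg_lim; first exact: norm_hausdorff.
rewrite -(cvg_shiftn k).
rewrite (_ : [sequence _]_n = fun n => \sum_(j < k) stick X j p.1 * (Tr j p.1 == l)%:R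
   + D * (\sum_(j < n) stick X j p.2 * (T j p.2 == l)%:R)).
  apply: cvgD; first exact: cvg_cst.
  apply: cvgMr; apply: is_cvg_ram => j; exact: X01.
apply/funext => n /=; rewrite addnC big_split_ord /=; congr (_ + _).
  by apply: eq_bigr => j _; rewrite slt // Tlt // ltnW.
by rewrite mulr_sumr; apply: eq_bigr => j _; rewrite sge Tge -mulrA.
Qed.

End splice_ram.

(** * Return times of the Markov chain *)

Section return_time.
Set Implicit Arguments.
Unset Strict Implicit.
Context {R : realType} {d : measure_display} {Omega : measurableType d}.
Context (P : probability Omega R) {S : pointedType} (cS : countable [set: S]).
Context (Q : S -> S -> R) (Q0 : forall i j, 0 <= Q i j).

Lemma esum_enum (e : S -> nat) (g : nat -> S) (K : set S) (a : S -> \bar R) :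
  cancel e g -> (forall s, 0 <= a s)%E ->
  (\esum_(k in K) a k = \sum_(n <oo | n \in e @` K) a (g n))%E.
Proof.
move=> eg a0; rewrite nneseries_esum //.
rewrite (_ : [set x | x \in e @` K] = e @` K).
  rewrite esum_image; last by move=> x y _ _; exact: (can_inj eg).
  by apply: eq_esum => k _; rewrite eg.
by apply/seteqP; split => n /=; rewrite inE.
Qed.

Lemma measurable_fiber (f : Omega -> S) (K : set S) :
  (forall s, measurable (f @^-1` [set s])) -> measurable (f @^-1` K).
Proof.
move=> mf; have [e [g eg]] := countable_cancel cS.
rewrite (_ : f @^-1` K = \bigcup_(n in e @` K) (f @^-1` [set g n])).
  exact: bigcup_measurable.
apply/seteqP; split => [w Kw|w [_ [k Kk <-]] /=].
  by exists (e (f w)) => //=; exists (f w).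
by rewrite eg => ->.
Qed.

Lemma measure_fibers (f : Omega -> S) (K : set S) (A : set Omega) :
  (forall s, measurable (f @^-1` [set s])) -> measurable A ->
  (\esum_(k in K) P (A `&` f @^-1` [set k]) = P (A `&` f @^-1` K))%E.
Proof.
move=> mf mA; have [e [g eg]] := countable_cancel cS.
rewrite (esum_enum K eg) // -measure_bigcup.
- congr (P _); apply/seteqP; split => [w [_ [k Kk <-]] [Aw /=]|w [Aw Kw]].
    by rewrite eg => fk; split => //=; rewrite fk.
  by exists (e (f w)) => /=; [exists (f w)|split => //=; rewrite eg].
- by move=> n _; exact: measurableI.
- move=> _ _ [k Kk <-] [l Kl <-] [w [[_ /= +] [_ /=]]].
  by rewrite !eg => -> ->.
Qed.

Lemma first_passage_ge0 n i j : (0 <= first_passage Q n i j)%E.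
Proof.
elim: n i j => [|n IH] i j /=; first by rewrite lee_fin.
by apply: esum_ge0 => k _; rewrite mule_ge0 // lee_fin.
Qed.

Context (mu : S -> R) (T : nat -> Omega -> S).
Hypothesis mT : forall n s, measurable (T n @^-1` [set s]).
Hypothesis PT : forall n (s : nat -> S),
  P (cyl_T T n.+1 s) = (mu (s 0%N) * \prod_(j < n) Q (s j) (s j.+1))%:E.

(** The first-passage event seen from time [m], with [n] counted as in [first_passage]: [n = 0] is a
    visit at the very next step. *)
Definition hit (m n : nat) (j : S) : set Omega :=
  [set w | (forall l, (m < l <= m + n)%N -> T l w <> j) /\ T (m + n).+1 w = j].

Lemma measurable_hit m n j : measurable (hit m n j).
Proof.
rewrite (_ : hit m n j =
    \bigcap_(l in [set l | (m < l <= m + n)%N]) ~` (T l @^-1` [set j])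
    `&` T (m + n).+1 @^-1` [set j]) //.
apply: measurableI => //; apply: bigcap_measurableType => l _.
exact: measurableC.
Qed.

Let extend (s : nat -> S) m k : nat -> S := fun l => if (l <= m)%N then s l else k.

Lemma cyl_T_extend m s k :
  cyl_T T m.+1 s `&` T m.+1 @^-1` [set k] = cyl_T T m.+2 (extend s m k).
Proof.
apply/seteqP; split => [w [cw Tw] l /=|w cw].
  rewrite ltnS leq_eqVlt => /orP[/eqP ->|lm].
    by rewrite /extend ltnn; exact: Tw.
  have lm' : (l <= m)%N by rewrite -ltnS.
  by rewrite /extend /= lm'; exact: cw.
split=> [l /= lm|].
  have lm' : (l <= m)%N by rewrite -ltnS.
  have := cw l; rewrite /extend /= lm'; apply.
  exact: leq_trans lm _.
by have := cw m.+1; rewrite /extend /= ltnn; apply.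
Qed.

Lemma P_cyl_T_extend m s k :
  P (cyl_T T m.+2 (extend s m k)) = (P (cyl_T T m.+1 s) * (Q (s m) k)%:E)%E.
Proof.
rewrite !PT -EFinM; congr (_%:E); rewrite big_ord_recr /= mulrA.
have -> : extend s m k m = s m by rewrite /extend leqnn.
have -> : extend s m k m.+1 = k by rewrite /extend ltnn.
congr (_ * _ * _); apply: eq_bigr => l _.
by rewrite /extend ltn_ord ltnW.
Qed.

(** Conditioning on the whole prefix [s] reduces the Markov property to the product formula for
    cylinders. The induction splits on the state at time [m + 1] and lengthens the prefix, as in the
    recursion of [first_passage]. *)
Lemma P_hit m n j s :
  P (cyl_T T m.+1 s `&` hit m n j) =
  (P (cyl_T T m.+1 s) * first_passage Q n (s m) j)%E.
Proof.
elim: n m s => [|n IH] m s.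
  rewrite -P_cyl_T_extend -cyl_T_extend; congr (P (_ `&` _)).
  apply/seteqP; split => [w []|w wj]; first by rewrite addn0.
  split; last by rewrite addn0.
  by move=> l /andP[ml]; rewrite addn0 leqNgt ml.
have -> : cyl_T T m.+1 s `&` hit m n.+1 j =
    (cyl_T T m.+1 s `&` hit m.+1 n j) `&` T m.+1 @^-1` [set k | k != j].
  rewrite /hit addSnnS; apply/seteqP; split => [w [cw [nw Tw]]|w [[cw [nw Tw]] /eqP Tm]].
    split; [split=> //; split=> // l /andP[ml lm]|apply/eqP].
      by apply: nw; rewrite lm (ltn_trans _ ml).
    by apply: nw; rewrite ltnSn -addSnnS leq_addr.
  split=> //; split=> // l /andP[ml lm].
  move: ml; rewrite leq_eqVlt => /orP[/eqP <- //|ml].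
  by apply: nw; rewrite ml.
rewrite -measure_fibers //; last first.
  by apply: measurableI; [exact: measurable_cyl_T|exact: measurable_hit].
have -> : (P (cyl_T T m.+1 s) * first_passage Q n.+1 (s m) j =
    \esum_(k in [set k | k != j]) (P (cyl_T T m.+1 s) *
       ((Q (s m) k)%:E * first_passage Q n k j)))%E.
  have [e [g eg]] := countable_cancel cS.
  have F0 k : (0 <= (Q (s m) k)%:E * first_passage Q n k j)%E.
    by rewrite mule_ge0 ?lee_fin ?first_passage_ge0.
  rewrite /= !(esum_enum _ eg) //; last by move=> k; rewrite mule_ge0.
  rewrite -[P _]fineK ?nneseriesZl //.
  by apply: fin_num_measure; exact: measurable_cyl_T.
apply: eq_esum => k _; rewrite setIAC cyl_T_extend IH P_cyl_T_extend muleA.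
by rewrite /extend ltnn.
Qed.

(** The events of first return at time [n + 1] are disjoint and have probabilities
    [first_passage Q n i i], which sum to 1 by recurrence; [N] is the complement of their union. *)
Lemma return_negligible i : mu = dirac_vec i -> recurrent Q i ->
  exists N, [/\ measurable N, P N = 0%E &
    forall w, ~ N w -> exists k, first_ret (T ^~ w) i k].
Proof.
move=> muE rec; pose H n := cyl_T T 1 (fun=> i) `&` hit 0 n i.
have mH n : measurable (H n).
  by apply: measurableI; [exact: measurable_cyl_T|exact: measurable_hit].
exists (~` \bigcup_n H n); split.
- by apply: measurableC; exact: bigcup_measurable.
- rewrite probability_setC; last exact: bigcup_measurable.
  suff -> : P (\bigcup_n H n) = 1%E by rewrite subee.
  rewrite measure_bigcup //; last first.
    move=> m n _ _ [w [[_ [nm Tm]] [_ [nn Tn]]]].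
    move: nm Tm nn Tn; rewrite !add0n => nm Tm nn Tn.
    case: (ltngtP m n) => // mn; first by case: (nn m.+1).
    by case: (nm n.+1).
  rewrite -[RHS]rec; congr (limn _); apply/funext => n.
  apply: eq_big => [k|k _]; first by rewrite in_setT.
  by rewrite /H [LHS]P_hit PT big_ord0 muE /dirac_vec eqxx mulr1 mul1e.
- move=> w; rewrite /setC /= notK => -[n _ [_ [nw]]].
  rewrite add0n => Tw; exists n.+1; rewrite /first_ret Tw eqxx /=.
  apply/forallP => l; apply/implyP => l0; apply/eqP; apply: nw.
  by rewrite l0 /= add0n -ltnS.
Qed.

End return_time.

(** * Law of the spliced path *)

Section splice_law.
Set Implicit Arguments.
Unset Strict Implicit.
Context {R : realType} {d : measure_display} {Omega : measurableType d}.
Context (P : probability Omega R) {S : pointedType} (cS : countable [set: S]).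
Context (Q : S -> S -> R) (mu : S -> R) (X : nat -> Omega -> R).
Context (T Tr : nat -> Omega -> S) (i : S).
Hypothesis iid : iid_fractions P X.
Hypothesis markov_T : markov_chain P Q mu T.
Hypothesis markov_Tr : markov_chain P Q (dirac_vec i) Tr.
Hypothesis indep_T : indep_seq P X T.
Hypothesis indep_Tr : indep_seq P X Tr.

Let mX j : measurable_fun [set: Omega] (X j). Proof. exact: iid.1. Qed.
Let X01 j w : 0 <= X j w <= 1. Proof. exact: iid.2.1. Qed.
Let mT n s : measurable (T n @^-1` [set s]). Proof. exact: markov_T.1. Qed.
Let mTr n s : measurable (Tr n @^-1` [set s]). Proof. exact: markov_Tr.1. Qed.

Let px (B : set R) : R := fine (P (X 0%N @^-1` B)).

Let P_cyl_X n (A : nat -> set R) : (forall j, measurable (A j)) ->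
  P (cyl_X X n A) = (\prod_(j < n) px (A j))%:E.
Proof.
move=> mA; rewrite iid.2.2 // -prodEFin; apply: eq_bigr => j _.
rewrite /px fineK //; apply: fin_num_measure.
by have := mX 0 measurableT (mA j); rewrite setTI.
Qed.

Let P_cyl_XT n A s : (forall j, measurable (A j)) ->
  P (cyl_X X n.+1 A `&` cyl_T T n.+1 s) =
  (\prod_(j < n.+1) px (A j) * (mu (s 0%N) * \prod_(j < n) Q (s j) (s j.+1)))%:E.
Proof. by move=> mA; rewrite indep_T // P_cyl_X // markov_T.2. Qed.

Let P_cyl_XTr n A s : (forall j, measurable (A j)) ->
  P (cyl_X X n.+1 A `&` cyl_T Tr n.+1 s) =
  (\prod_(j < n.+1) px (A j) * ((s 0%N == i)%:R * \prod_(j < n) Q (s j) (s j.+1)))%:E.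
Proof. by move=> mA; rewrite indep_Tr // P_cyl_X // markov_Tr.2. Qed.

Let pxT : px setT = 1.
Proof. by rewrite /px preimage_setT probability_setT. Qed.

(** One more state than fractions: at the return time the first copy supplies the state and the
    second the fraction. *)
Let P_cyl_XTr_next n A s : (forall j, measurable (A j)) ->
  P (cyl_X X n A `&` cyl_T Tr n.+1 s) =
  (\prod_(j < n) px (A j) * ((s 0%N == i)%:R * \prod_(j < n) Q (s j) (s j.+1)))%:E.
Proof.
move=> mA; pose A' j := if (j < n)%N then A j else setT.
have -> : cyl_X X n A = cyl_X X n.+1 A'.
  apply/seteqP; split => w cw j /= jn.
    by rewrite /A'; case: ifP => // /cw.
  by have := cw j (ltnW jn); rewrite /A' jn.
rewrite P_cyl_XTr; last by move=> j; rewrite /A'; case: ifP.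
rewrite big_ord_recr /= {2}/A' ltnn pxT mulr1; congr ((_ * _)%:E).
by apply: eq_bigr => j _; rewrite /A' ltn_ord.
Qed.

Definition path_of (w : Omega) : @pathsp R S := fun j => (X j w, T j w).

Definition splice_path (p : Omega * Omega) : @pathsp R S :=
  fun j => (splice_X X Tr i j p, splice_T T Tr i j p).

Lemma path_of_cyl n A s :
  path_of @^-1` path_cyl n A s = cyl_X X n A `&` cyl_T T n s.
Proof.
apply/seteqP; split => [w wc|w [Xw Tw] j jn].
  by split => j /= jn; have [] := wc j jn.
by split; [exact: Xw|exact: Tw].
Qed.

(** As long as [s] has not returned, the splice does not consult the second copy. *)
Lemma splice_path_cyl_noret n A s : (forall k, (k < n)%N -> ~~ first_ret s i k) ->
  splice_path @^-1` path_cyl n A s = (cyl_X X n A `&` cyl_T Tr n s) `*` setT.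
Proof.
move=> nr.
have key p : (forall j, (j < n)%N -> Tr j p.1 = s j) -> forall j, (j < n)%N ->
    splice_path p j = (X j p.1, s j).
  move=> ts j jn; rewrite -ts // /splice_path; congr (_, _).
    apply: splice_frac_before => k kj.
    rewrite (eq_first_ret (s := s)) ?nr ?(leq_ltn_trans kj) // => l lk.
    by rewrite ts // (leq_ltn_trans lk) // (leq_ltn_trans kj).
  apply: splice_chain_before => k kj.
  rewrite (eq_first_ret (s := s)) ?nr ?(ltn_trans kj) // => l lk.
  by rewrite ts // (leq_ltn_trans lk) // (ltn_trans kj).
apply/seteqP; split => [p pc|p [[Xp Tp] _] j jn].
  have ts j : (j < n)%N -> Tr j p.1 = s j.
    move=> jn; apply: (splice_chain_prefix (t := Tr ^~ p.1) (u := T ^~ p.2) (n := n) _ nr) => //.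
      by move=> l ln; have [] := pc l ln.
    exact: ltnW.
  split=> //; split=> j /= jn; last exact: ts.
  by have [+ _] := pc j jn; rewrite key.
by rewrite key //; split => //; exact: Xp.
Qed.

(** The conditions before the return fall on the first copy, those after it on the second. The
    second chain stays free at time 0, where the splice reads the first chain. *)
Lemma splice_path_cyl_ret n A s k : first_ret s i k -> (k < n)%N ->
  splice_path @^-1` path_cyl n A s =
  (cyl_X X k A `&` cyl_T Tr k.+1 s) `*`
  (cyl_X X (n - k) (fun j => A (k + j)%N) `&`
   [set w | forall j, (0 < j < n - k)%N -> T j w = s (k + j)%N]).
Proof.
move=> rk kn.
have ret (p : Omega * Omega) : (forall j, (j <= k)%N -> Tr j p.1 = s j) -> first_ret (Tr ^~ p.1) i k.
  by move=> ts; rewrite (eq_first_ret (s := s)).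
apply/seteqP; split => [p pc|p [[Xp Tp] [Yp Up]] j jn].
  have ts j : (j <= k)%N -> Tr j p.1 = s j.
    move=> jk; apply: (splice_chain_prefix (t := Tr ^~ p.1) (u := T ^~ p.2)
      (i := i) (n := n) (m := k)) => //.
    - by move=> l ln; have [] := pc l ln.
    - move=> m mk; apply/negP => rm.
      by move: mk; rewrite (first_ret_inj rm rk) ltnn.
    - exact: leq_ltn_trans jk kn.
  have rt := ret p ts.
  split; split.
  - move=> j /= jk; have [+ _] := pc j (ltn_trans jk kn).
    by rewrite /splice_path /= /splice_X (splice_frac_lt _ _ rt).
  - by move=> j /= jk; exact: ts.
  - move=> j /= jk; have [|+ _] := pc (k + j)%N; first by rewrite -ltn_subRL.
    by rewrite /splice_path /= /splice_X (splice_frac_after _ _ rt) ?leq_addr // addKn.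
  - move=> j /= /andP[j0 jk]; have [|_ <-] := pc (k + j)%N; first by rewrite -ltn_subRL.
    rewrite /splice_path /= /splice_T (splice_chain_after _ rt) ?addKn //.
    by rewrite -[X in (X < _)%N]addn0 ltn_add2l.
have ts l : (l <= k)%N -> Tr l p.1 = s l by move=> lk; exact: Tp.
have rt := ret p ts.
rewrite /splice_path /= /splice_X /splice_T; split.
  case: (ltnP j k) => jk; first by rewrite (splice_frac_lt _ _ rt) //; exact: Xp.
  rewrite (splice_frac_after _ _ rt) //.
  by have := Yp (j - k)%N; rewrite /= subnKC //; apply; rewrite ltn_sub2r.
case: (leqP j k) => jk; first by rewrite (splice_chain_le _ rt) // ts.
rewrite (splice_chain_after _ rt) // Up ?subnKC ?(ltnW jk) //.
by rewrite subn_gt0 jk ltn_sub2r // (ltn_trans _ jn).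
Qed.

(** The conditional probability given [T 0 = i], left unnormalised with mass [mu i]. *)
Let m_i := mrestr P (mT 0 i).

Let measurable_tail n k s :
  measurable [set w | forall j, (0 < j < n - k)%N -> T j w = s (k + j)%N].
Proof.
rewrite (_ : [set w | _] = \bigcap_(j in [set j | (0 < j < n - k)%N])
  (T j @^-1` [set s (k + j)%N])) //.
by apply: bigcap_measurableType.
Qed.

Lemma measurable_path_of : measurable_fun [set: Omega] path_of.
Proof.
apply: measurable_fun_pathsp => n A s mA; rewrite path_of_cyl.
by apply: measurableI; [exact: measurable_cyl_X|exact: measurable_cyl_T].
Qed.

Lemma first_ret_lt_dec s n : (exists2 k, (k < n)%N & first_ret s i k) \/
  (forall k, (k < n)%N -> ~~ first_ret s i k).
Proof.
have [[k kn rk]|nk] := pselect (exists2 k, (k < n)%N & first_ret s i k).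
  by left; exists k.
by right=> k kn; apply/negP => rk; apply: nk; exists k.
Qed.

Lemma measurable_splice_path : measurable_fun [set: Omega * Omega] splice_path.
Proof.
apply: measurable_fun_pathsp => n A s mA.
case: (first_ret_lt_dec s n) => [[k kn rk]|nr].
  rewrite (splice_path_cyl_ret _ rk) //; apply: measurableX; apply: measurableI => //.
  - exact: measurable_cyl_X.
  - exact: measurable_cyl_T.
  - exact: measurable_cyl_X.
rewrite splice_path_cyl_noret //; apply: measurableX => //; apply: measurableI.
  exact: measurable_cyl_X.
exact: measurable_cyl_T.
Qed.

Let m_iT : m_i setT = (mu i)%:E.
Proof.
rewrite /m_i /mrestr setTI.
have := markov_T.2 0%N (fun=> i); rewrite big_ord0 mulr1 => <-.
congr (P _); apply/seteqP; split => [w Tw [|j] //|w cw].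
by have := cw 0%N; apply.
Qed.

Let m_i_cyl n A s : (forall j, measurable (A j)) ->
  m_i (path_of @^-1` path_cyl n.+1 A s) =
  ((s 0%N == i)%:R * (\prod_(j < n.+1) px (A j) *
     (mu i * \prod_(j < n) Q (s j) (s j.+1))))%:E.
Proof.
move=> mA; rewrite /m_i /mrestr path_of_cyl.
have [s0|s0] := eqVneq (s 0%N) i.
  rewrite mul1r -s0 -P_cyl_XT //; congr (P _); apply: setIidl => w [_ cw].
  by exact: (cw 0%N).
rewrite mul0r (_ : _ `&` _ = set0) ?measure0 //.
apply/seteqP; split => // w [[_ cw] Tw].
by move: s0; rewrite -(cw 0%N) // Tw eqxx.
Qed.

Let m_i_prod A1 A2 : measurable A1 -> measurable A2 ->
  ((P \x m_i) (A1 `*` A2) = P A1 * m_i A2)%E.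
Proof. by move=> mA1 mA2; rewrite product_measure1E. Qed.

(** On cylinders both sides are products of fraction and transition probabilities, and these
    products factor at the first return of [s] to [i]. *)
Lemma splice_law B : measurable B ->
  (P \x m_i)%E (splice_path @^-1` B) = m_i (path_of @^-1` B).
Proof.
have mO := measurable_path_of; have mS := measurable_splice_path.
move=> mB.
have key n A s : (forall j, measurable (A j)) ->
    (P \x m_i)%E (splice_path @^-1` path_cyl n A s) = m_i (path_of @^-1` path_cyl n A s).
  move=> mA; have mAk k j : measurable (A (k + j)%N) by [].
  have mXA k (A' : nat -> set R) : (forall j, measurable (A' j)) -> measurable (cyl_X X k A').
    exact: measurable_cyl_X.
  have mTA k s' : measurable (cyl_T Tr k s') by exact: measurable_cyl_T.
  case: n => [|n].
    have -> : path_cyl 0 A s = setT by apply/seteqP; split.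
    rewrite !preimage_setT -setXTT m_i_prod //.
    by rewrite probability_setT mul1e.
  rewrite m_i_cyl //.
  case: (first_ret_lt_dec s n.+1) => [[k kn rk]|nr]; last first.
    rewrite splice_path_cyl_noret // m_i_prod //; last first.
      by apply: measurableI => //; exact: mXA.
    by rewrite m_iT P_cyl_XTr // -EFinM; congr (_%:E); ring.
  have nkE : (n.+1 - k = (n - k).+1)%N by rewrite subSn.
  have sk : s k = i by case/and3P: rk => _ /eqP.
  rewrite (splice_path_cyl_ret _ rk) // m_i_prod //; last 2 first.
  - by apply: measurableI => //; exact: mXA.
  - by apply: measurableI => //; exact: mXA.
  (* Under [m_i] the second chain starts at [i = s k], so the missing condition at time 0 can be
     added. *)
  rewrite P_cyl_XTr_next // (_ : m_i _ =
      m_i (path_of @^-1` path_cyl (n - k).+1 (fun j => A (k + j)%N) (fun j => s (k + j)%N))).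
    rewrite m_i_cyl // addn0 sk eqxx mul1r -EFinM; congr (_%:E).
    rewrite -[in RHS](subnKC (_ : k <= n)%N) // -addnS !big_split_ord /=.
    under [X in _ = _ * (_ * (_ * (_ * X)))]eq_bigr do rewrite -addnS.
    ring.
  rewrite /m_i /mrestr path_of_cyl nkE; congr (P _); apply/seteqP.
  split => [w [[Xw Tw] T0]|w [[Xw Tw] T0]]; split => //; split => //.
    case=> [|j] /= jn; first by rewrite addn0 sk.
    by apply: Tw; rewrite ltn0Sn.
  by move=> j /andP[_ jn]; exact: Tw.
rewrite -[LHS]/(pushforward (P \x m_i)%E splice_path B).
rewrite -[RHS]/(pushforward m_i path_of B).
apply: path_measure_unique => //.
rewrite -[X in (X < _)%E]/((P \x m_i)%E setT) -setXTT m_i_prod //.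
by rewrite probability_setT mul1e m_iT ltry.
Qed.

Lemma ram_path_of w :
  ram_measure path_frac path_state (path_of w) = ram_measure X T w.
Proof.
by apply: eq_ram_measure => j //; rewrite path_frac_id //; exact: X01.
Qed.

Lemma ram_splice_path p :
  ram_measure path_frac path_state (splice_path p) =
  ram_measure (splice_X X Tr i) (splice_T T Tr i) p.
Proof.
apply: eq_ram_measure => j //; rewrite path_frac_id //=.
by rewrite /splice_X /splice_frac; case: pickP => *; exact: X01.
Qed.

(** [splice_law] is applied to the occupation measure of a path, then rewritten by the pathwise
    identity [splice_ram]. The factors of the product space carry the excursion and its independent
    continuation. *)
Lemma ram_fixed_point (N : set Omega) (B : set (mconf R S)) :
  measurable N -> P N = 0%E ->
  (forall w, ~ N w -> exists k, first_ret (Tr ^~ w) i k) ->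
  measurable B ->
  P (ram_measure X T @^-1` B `&` T 0%N @^-1` [set i]) =
  (P \x m_i)%E
    [set p | B (mix (exc_mass X Tr i p.1) (exc_eta X Tr i p.1) (ram_measure X T p.2))].
Proof.
move=> mN PN ret mB.
have mR := measurable_path_ram (R := R) cS.
have mRB : measurable (ram_measure path_frac path_state @^-1` B : set (@pathsp R S)).
  by have := mR measurableT _ mB; rewrite setTI.
transitivity (m_i (path_of @^-1` (ram_measure path_frac path_state @^-1` B))).
  rewrite /m_i /mrestr; congr (P (_ `&` _)).
  by apply/seteqP; split => w /=; rewrite ram_path_of.
rewrite -splice_law //.
set D1 := splice_path @^-1` _; set D2 := [set p | _].
have mD1 : measurable D1.
  by have := measurable_splice_path measurableT mRB; rewrite setTI.
have mram : measurable_fun [set: Omega] (ram_measure X T) by exact: measurable_ram.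
have mD2 : measurable D2.
  pose f (p : Omega * Omega) : mconf R S :=
    mix (exc_mass X Tr i p.1) (exc_eta X Tr i p.1) (ram_measure X T p.2).
  have mf : measurable_fun [set: Omega * Omega] f.
    apply: measurable_fun_mconf => l.
    under eq_fun do rewrite /f mix_excE //.
    apply: measurable_funD.
      by apply: (measurableT_comp (measurable_exc_part mX X01 mTr i l)).
    apply: measurable_funM.
      apply: measurable_funB => //.
      exact: (measurableT_comp (measurable_exc_mass mX X01 mTr i)).
    exact: (measurableT_comp (measurableT_comp (measurable_mconf_eval l) mram)).
  by have := mf measurableT _ mB; rewrite setTI.
(* The identity may fail only if the excursion does not end or the second chain does not start at
   [i]; the latter is null for [m_i]. *)
pose N2 := N `*` setT `|` setT `*` ~` (T 0%N @^-1` [set i]).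
have mN1 : measurable (N `*` [set: Omega]) by exact: measurableX.
have mN3 : measurable ([set: Omega] `*` ~` (T 0%N @^-1` [set i])).
  by apply: measurableX => //; exact: measurableC.
have mN2 : measurable N2 by exact: measurableU.
have N20 : (P \x m_i)%E N2 = 0%E.
  apply/eqP; rewrite eq_le measure_ge0 andbT.
  apply: (le_trans (measureU2 _ _ _)) => //.
  rewrite [X in (X + _ <= _)%E]m_i_prod // [X in (_ + X <= _)%E]m_i_prod //; last first.
    exact: measurableC.
  by rewrite PN mul0e add0e /m_i /mrestr setICl measure0 mule0.
have D12 : D1 `\` N2 = D2 `\` N2.
  have E p : ~ N2 p -> ram_measure path_frac path_state (splice_path p) =
      mix (exc_mass X Tr i p.1) (exc_eta X Tr i p.1) (ram_measure X T p.2).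
    move=> nN; have [k rk] : exists k, first_ret (Tr ^~ p.1) i k.
      by apply: ret => Np; apply: nN; left; split.
    rewrite ram_splice_path (splice_ram X01 rk) //.
    by apply: contrapT => Tp; apply: nN; right; split.
  by apply/seteqP; split => p [Dp nN]; split => //; move: Dp; rewrite /D1 /D2 /= E.
have DN (D : set (Omega * Omega)) : measurable D ->
    (P \x m_i)%E D = (P \x m_i)%E (D `\` N2).
  move=> mD; rewrite (measureDI (P \x m_i)%E mD mN2).
  rewrite [X in (_ + X)%E](_ : _ = 0%E) ?adde0 //.
  exact: (@subset_measure0 _ _ _ (P \x m_i)%E (D `&` N2) N2 (measurableI _ _ mD mN2)
    mN2 (@subIsetr _ _ _) N20).
by rewrite [LHS]DN // [RHS]DN // D12.
Qed.

End splice_law.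

(** * Conditional laws *)

Section conditional_laws.
Set Implicit Arguments.
Unset Strict Implicit.
Context {R : realType} {S : pointedType} (cS : countable [set: S]).
Implicit Types (lam : {measure set (mconf R S * dstate S) -> \bar R}).

Lemma measurable_slice (B : set (mconf R S)) (s : S) :
  measurable B -> measurable (B `*` [set s : dstate S]).
Proof. by move=> mB; exact: measurableX. Qed.

Lemma slice_measure lam (s : S) : (lam setT < +oo)%E ->
  exists a : {finite_measure set (mconf R S) -> \bar R},
    forall B, a B = lam (B `*` [set s : dstate S]).
Proof.
move=> lamoo.
pose r := mrestr lam (measurable_slice s measurableT).
pose pf := pushforward r (@fst (mconf R S) (dstate S)).
have mfst : measurable_fun [set: mconf R S * dstate S] fst by exact: measurable_fst.
have pfE B : pf B = lam (B `*` [set s : dstate S]).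
  rewrite /pf /pushforward /r /mrestr; congr (lam _).
  by apply/seteqP; split => -[m t] /= [Bm]; [move=> [_ ts]|move=> ts].
pose pm : {measure set (mconf R S) -> \bar R} :=
  measure_function_pushforward__canonical__measure_function_Measure r mfst.
have pfoo : (pm setT < +oo)%E.
  rewrite [ltLHS]pfE; apply: le_lt_trans lamoo.
  by apply: le_measure; rewrite ?inE //; exact: measurable_slice.
exists (mfrestr (measurableT : measurable [set: mconf R S]) pfoo) => B.
by rewrite -[LHS]/(pf (B `&` setT)) setIT.
Qed.

(** The second coordinate is countable, so [E] is a countable disjoint union of slices over single
    states. *)
Lemma slices_unique lam lam' :
  (forall s B, measurable B ->
     lam (B `*` [set s : dstate S]) = lam' (B `*` [set s : dstate S])) ->
  forall E, measurable E -> lam E = lam' E.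
Proof.
move=> ll E mE; have [e [g eg]] := countable_cancel cS.
pose F n : set (mconf R S * dstate S) := ysection E (g n : dstate S) `*` [set g n : dstate S].
have EF : E = \bigcup_(n in range e) F n.
  apply/seteqP; split => [[m s] Es|[m s] [_ [t _ <-]] []].
    exists (e s); first by exists s.
    by rewrite /F eg; split => //=; rewrite /ysection /= inE.
  by rewrite eg /ysection /= inE => Es ->.
have mF n : measurable (F n) by apply: measurable_slice; exact: measurable_ysection.
have tF : trivIset (range e) F.
  move=> _ _ [s _ <-] [t _ <-] [[m u] [[_ /= +] [_ /=]]].
  by rewrite !eg => -> ->.
rewrite EF !measure_bigcup //; congr (limn _); apply/funext => n.
by apply: eq_bigr => k _; apply: ll; exact: measurable_ysection.
Qed.

Context {d : measure_display} {Omega : measurableType d} (P : probability Omega R).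

Lemma cond_lawE (lam : set (mconf R S * dstate S) -> \bar R) (s : S) (r : R) B :
  0 < r -> lam ([set: mconf R S] `*` [set s : dstate S]) = r%:E ->
  cond_law lam s B = (lam (B `*` [set s : dstate S]) * (r^-1)%:E)%E.
Proof. by move=> r0 lamT; rewrite /cond_law lamT inver gt_eqF. Qed.

Lemma cond_law_prodE (lam : set (mconf R S * dstate S) -> \bar R) (s : S) (r : R)
    (a : {finite_measure set (mconf R S) -> \bar R}) D :
  0 < r -> lam ([set: mconf R S] `*` [set s : dstate S]) = r%:E ->
  (forall B, a B = lam (B `*` [set s : dstate S])) -> measurable D ->
  ((P \x cond_law lam s) D = (P \x a) D * (r^-1)%:E)%E.
Proof.
move=> r0 lamT aE mD; rewrite /product_measure1 /=.
under eq_integral do rewrite /= (cond_lawE _ r0 lamT) -aE.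
rewrite ge0_integralZr //; first exact: measurable_fun_xsection.
by rewrite lee_fin invr_ge0 ltW.
Qed.

(** Both sides carry the factor [r^-1]. Clearing it passes from [cond_law], a bare set function, to
    the finite measure [a]. *)
Lemma cond_law_fixedP (lam : set (mconf R S * dstate S) -> \bar R) (s : S) (r : R)
    (a : {finite_measure set (mconf R S) -> \bar R}) (b : Omega -> R) (c : Omega -> S -> R) :
  measurable_fun [set: Omega] b ->
  (forall l, measurable_fun [set: Omega] (c ^~ l)) ->
  0 < r -> lam ([set: mconf R S] `*` [set s : dstate S]) = r%:E ->
  (forall B, a B = lam (B `*` [set s : dstate S])) ->
  (forall B, measurable B ->
     cond_law lam s B = (P \x cond_law lam s)%E (aff b c @^-1` B)) <->
  aff_invariant P b c a.
Proof.
move=> mb mc r0 lamT aE.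
have maff B : measurable B -> measurable (aff b c @^-1` B).
  by move=> mB; have := measurable_aff b c mb mc measurableT B mB; rewrite setTI.
split=> H B mB.
  have := H B mB; rewrite (cond_lawE _ r0 lamT) -aE (cond_law_prodE r0 lamT aE); last exact: maff.
  by move/(congr1 (fun x => x * r%:E)%E); rewrite -!muleA -EFinM mulVf ?gt_eqF // !mule1.
rewrite (cond_lawE _ r0 lamT) -aE (cond_law_prodE r0 lamT aE); last exact: maff.
by rewrite (H B mB).
Qed.

End conditional_laws.

(** * Contraction on average *)

Section contraction.
Set Implicit Arguments.
Unset Strict Implicit.
Context {R : realType} {d : measure_display} {Omega : measurableType d}.
Context (P : probability Omega R) (X : nat -> Omega -> R).
Hypothesis iid : iid_fractions P X.

Lemma iid_marginal j (A : set R) : measurable A -> P (X j @^-1` A) = P (X 0%N @^-1` A).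
Proof.
move=> mA; pose A' k := if k == j then A else setT.
have mA' k : measurable (A' k) by rewrite /A'; case: ifP.
have <- : cyl_X X j.+1 A' = X j @^-1` A.
  apply/seteqP; split => [w /(_ j (ltnSn j))|w Aw k _ /=]; first by rewrite /A' eqxx.
  by rewrite /A'; case: eqP => // ->.
rewrite iid.2.2 // big_ord_recr /= {2}/A' eqxx big1 ?mul1e // => k _.
by rewrite /A' ltn_eqF // preimage_setT probability_setT.
Qed.

(** With mean 0, all fractions would vanish almost surely, and the sticks could not sum to 1. *)
Lemma integral_frac_gt0 : RAM_condition P X -> (0 < \int[P]_w (X 0%N w)%:E)%E.
Proof.
move=> ram.
have mX j : measurable_fun [set: Omega] (X j) by exact: iid.1.
have X01 j w : 0 <= X j w <= 1 by exact: iid.2.1.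
rewrite lt_neqAle eq_sym; apply/andP; split; last first.
  by apply: integral_ge0 => w _; rewrite lee_fin; case/andP: (X01 0%N w).
apply/negP => /eqP int0.
have X0 : ae_eq P setT (EFin \o X 0%N) (cst 0%E).
  apply/ae_eq_integral_abs => //; first exact/measurable_EFinP.
  rewrite -[RHS]int0; apply: eq_integral => w _ /=.
  by rewrite ger0_norm //; case/andP: (X01 0%N w).
have mN0 : measurable (~` [set (0 : R)]) by exact: measurableC.
have P0 : P (X 0%N @^-1` ~` [set 0]) = 0%E.
  apply: (measure_negligible _ _).
    by have := mX 0%N measurableT _ mN0; rewrite setTI.
  apply: negligibleS X0 => w /= Xw; apply: contra_not Xw => h.
  by have [] := h I.
have aeX : {ae P, forall w j, X j w = 0}.
  apply: ae_foralln => j; exists (X j @^-1` ~` [set 0]); split.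
  - by have := mX j measurableT _ mN0; rewrite setTI.
  - by rewrite -P0; exact: iid_marginal.
  - by move=> w /= Xw.
have [N [mN PN sub]] : {ae P, forall w, False}.
  move: ram aeX; apply: filterS2 => w ramw Xw.
  have : (fun n => \sum_(j < n) stick X j w) @ \oo --> (0 : R).
    rewrite (_ : (fun n => _) = cst 0); first exact: cvg_cst.
    by apply/funext => n; rewrite big1 // => j _; rewrite /stick Xw mul0r.
  move=> /(cvg_unique (@norm_hausdorff _ _) ramw) /eqP.
  by rewrite oner_eq0.
have := probability_setT P; rewrite (_ : setT = N); last first.
  by apply/seteqP; split => // w _; exact: sub.
by rewrite PN => /eqP; rewrite eq_sym onee_eq0.
Qed.

(** Pointwise [1 - exc_mass + X 0 <= 1] by [exc_mass_ge]; the positive mean of [X 0] gives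
    strictness. *)
Lemma integral_defect_lt1 {S : pointedType} (Tr : nat -> Omega -> S) (i : S) :
  RAM_condition P X -> (forall n s, measurable (Tr n @^-1` [set s])) ->
  (\int[P]_w (1 - exc_mass X Tr i w)%:E < 1)%E.
Proof.
move=> ram mTr.
have mX j : measurable_fun [set: Omega] (X j) by exact: iid.1.
have X01 j w : 0 <= X j w <= 1 by exact: iid.2.1.
have m01 w : 0 <= exc_mass X Tr i w <= 1 by exact: exc_mass01.
have mm := measurable_exc_mass mX X01 mTr i.
have mm1 : measurable_fun [set: Omega] (fun w => (1 - exc_mass X Tr i w)%:E).
  by apply/measurable_EFinP; exact: measurable_funB.
have m0 w : (0 <= (1 - exc_mass X Tr i w)%:E)%E.
  by rewrite lee_fin subr_ge0; case/andP: (m01 w).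
have X0 w : (0 <= (X 0%N w)%:E)%E by rewrite lee_fin; case/andP: (X01 0%N w).
have mX0 : measurable_fun [set: Omega] (fun w => (X 0%N w)%:E) by exact/measurable_EFinP.
have le1 : (\int[P]_w (1 - exc_mass X Tr i w)%:E + \int[P]_w (X 0%N w)%:E <= 1)%E.
  rewrite -ge0_integralD //.
  apply: (@le_trans _ _ (\int[P]_w (cst 1%E) w)%E).
    apply: ge0_le_integral => //.
    - by move=> w _; rewrite adde_ge0.
    - exact: emeasurable_funD.
    - move=> w _; rewrite -EFinD lee_fin.
      have := @exc_mass_ge _ _ _ _ X Tr i w (X01 ^~ w); lra.
  by rewrite integral_cst // mul1e; rewrite [leLHS]probability_setT.
have I0 := integral_frac_gt0 ram.
have If : (\int[P]_w (1 - exc_mass X Tr i w)%:E)%E \is a fin_num.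
  rewrite ge0_fin_numE ?integral_ge0 //.
  apply: (@le_lt_trans _ _ 1%E); last by rewrite ltry.
  by apply: le_trans le1; rewrite leeDl // ltW.
apply: lt_le_trans le1; rewrite lteDl //.
Qed.

End contraction.

(** * Existence and uniqueness of the fixed point *)

Theorem mainTheorem7 (R : realType) (d : measure_display)
  (Omega : measurableType d) (P : probability Omega R)
  (S : pointedType) (cS : countable [set: S])
  (Q : S -> S -> R) (mu : S -> R)
  (X : nat -> Omega -> R) (T : nat -> Omega -> S)
  (Tr : S -> nat -> Omega -> S) :
  stochastic_kernel Q ->
  prob_vector mu ->
  (forall s, ~ recurrent Q s -> mu s = 0) ->
  iid_fractions P X ->
  RAM_condition P X ->
  markov_chain P Q mu T ->
  indep_seq P X T ->
  (forall i, recurrent Q i ->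
     markov_chain P Q (dirac_vec i) (Tr i) /\ indep_aux P X T (Tr i)) ->
  fixed_point_char P Q mu X Tr (law_nuT P X T) /\
  (forall lam : probability (mconf R S * dstate S)%type R,
     fixed_point_char P Q mu X Tr lam ->
     forall E, measurable E -> lam E = law_nuT P X T E).
Proof.
move=> stochQ [mu0 _] transient iid ram markov_T indep_T markov_Tr.
have mX j : measurable_fun [set: Omega] (X j) by exact: iid.1.
have X01 j w : 0 <= X j w <= 1 by exact: iid.2.1.
have mT n s : measurable (T n @^-1` [set s]) by exact: markov_T.1.
have mram : measurable_fun [set: Omega] (ram_measure X T) by exact: measurable_ram.
have mnu : measurable_fun [set: Omega] (nuT X T).
  apply: measurable_fun_pair => //; move=> _ K _; rewrite setTI.
  by apply: measurable_fiber => // s; exact: mT.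
pose law : {measure set (mconf R S * dstate S) -> \bar R} :=
  measure_function_pushforward__canonical__measure_function_Measure P mnu.
have lawoo : (law setT < +oo)%E.
  by rewrite -[ltLHS]/(P setT) probability_setT ltry.
have lawE B s : law (B `*` [set s : dstate S]) =
    P (ram_measure X T @^-1` B `&` T 0%N @^-1` [set s]) by [].
have lawT s : law ([set: mconf R S] `*` [set s : dstate S]) = (mu s)%:E.
  rewrite lawE preimage_setT setTI.
  have := markov_T.2 0%N (fun=> s); rewrite big_ord0 mulr1 => <-.
  congr (P _); apply/seteqP; split => [w Tw [|j] //|w cw].
  by have := cw 0%N; apply.
have rec s : 0 < mu s -> recurrent Q s.
  by move=> mus; apply: contrapT => /transient mus0; rewrite mus0 ltxx in mus.
pose b s w : R := 1 - exc_mass X (Tr s) s w.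
pose c s w l : R := exc_part X (Tr s) s w l.
have mTr s : recurrent Q s -> forall n t, measurable (Tr s n @^-1` [set t]).
  by move=> rs; exact: (markov_Tr s rs).1.1.
have mb s : recurrent Q s -> measurable_fun [set: Omega] (b s).
  move=> rs; apply: measurable_funB => //.
  by apply: measurable_exc_mass => //; exact: mTr.
have mc s : recurrent Q s -> forall l, measurable_fun [set: Omega] (c s ^~ l).
  by move=> rs l; apply: measurable_exc_part => //; exact: mTr.
have affE s : (fun p : Omega * mconf R S =>
     (mix (exc_mass X (Tr s) s p.1) (exc_eta X (Tr s) s p.1) p.2 : mconf R S)) =
    aff (b s) (c s).
  by apply/funext => p; apply/funext => l; rewrite mix_excE.
(* Existence in unnormalised form; it also provides one of the two invariant measures compared for
   uniqueness. *)
have law_inv s (a : {finite_measure set (mconf R S) -> \bar R}) : recurrent Q s ->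
    (forall B, a B = law (B `*` [set s : dstate S])) -> aff_invariant P (b s) (c s) a.
  move=> rs aE B mB; have [mkTr indTr] := markov_Tr s rs.
  (* Taking the whole space as event for [nuT] leaves the independence of [X] and [Tr s]. *)
  have indep_Tr : indep_seq P X (Tr s).
    move=> n A t mA; have := indTr n A setT t mA measurableT.
    by rewrite preimage_setT setIT.
  have [N [mN PN ret]] : exists N, [/\ measurable N, P N = 0%E &
      forall w, ~ N w -> exists k, first_ret (Tr s ^~ w) s k].
    apply: (return_negligible cS _ mkTr.1 mkTr.2 erefl rs).
    by move=> i j; exact: (stochQ i).1.
  rewrite aE lawE (ram_fixed_point cS iid markov_T mkTr indep_T indep_Tr mN PN ret mB).
  (* The sections match because [a] is the image under [ram_measure X T] of [P] restricted to
     [T 0 = s]. *)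
  rewrite -affE /product_measure1; apply: eq_integral => w _ /=.
  by rewrite aE lawE.
split.
  split=> // s rs mus B mB.
  have [a aE] := slice_measure s lawoo.
  rewrite affE; apply: (cond_law_fixedP P (mb s rs) (mc s rs) mus (lawT s) aE).2 => //.
  exact: law_inv.
move=> lam [lamT lamF]; apply: (slices_unique cS (lam' := law)) => s B mB.
have lamoo : (lam setT < +oo)%E by rewrite probability_setT ltry.
(* A slice over a state of zero mass is null for both laws; a state of positive mass is
   recurrent. *)
have := mu0 s; rewrite le_eqVlt => /orP[/eqP mus|mus].
  have null (l : {measure set (mconf R S * dstate S) -> \bar R}) :
      l (setT `*` [set s : dstate S]) = (mu s)%:E -> l (B `*` [set s : dstate S]) = 0%E.
    move=> lT; apply: (subset_measure0 (B := setT `*` [set s : dstate S])).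
    - exact: measurable_slice.
    - exact: measurable_slice.
    - by move=> p [_ ps].
    - by move: lT; rewrite -mus.
  exact: (etrans (null _ (lamT s)) (esym (null _ (lawT s)))).
have rs := rec s mus.
have [a aE] := slice_measure s lawoo.
have [a' a'E] := slice_measure s lamoo.
rewrite -aE -a'E; apply: (aff_invariant_unique P (b s) (c s)) => //.
- exact: mb.
- exact: mc.
- move=> w; have /andP[m0 m1] := exc_mass01 (Tr s) s (X01 ^~ w).
  by rewrite /b subr_ge0 m1 gerBl m0.
- exact: (integral_defect_lt1 iid s ram (mTr s rs)).
- apply: (cond_law_fixedP P (mb s rs) (mc s rs) mus (lamT s) a'E).1 => B' mB'.
  by rewrite (lamF s rs mus B' mB') affE.
- exact: law_inv.
- by rewrite a'E aE lawT; exact: lamT.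
Qed.
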